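(* Up to isomorphism, the set of simple objects of the category $\mathscr C(\mathbf G)$, $\mathbf G=SL_2(\bar{\mathbb F}_q)$, is $$\operatorname{Irr}(\mathbf G)=\{\Bbbk_{\mathrm{tr}},\ \mathrm{St},\ \mathbb M(\theta)\mid\theta\in\widehat{\mathbf T}\text{ is nontrivial}\}.$$
   Context: Let $\mathbb{F}_q$ be a finite field with $q$ elements, $\bar{\mathbb{F}}_q$ its algebraic closure, and $\Bbbk$ an algebraically closed field of characteristic $0$. Let $\mathbf G=SL_2(\bar{\mathbb F}_q)$, regarded as an abstract group, with $\Bbbk\mathbf G$ its group algebra. Let $\mathbf T$, $\mathbf B$, $\mathbf U$ be the subgroups of diagonal, upper triangular, and upper unitriangular matrices respectively, and $\dot s=\begin{pmatrix}0&1\\-1&0\end{pmatrix}$. Let $\widehat{\mathbf T}$ be the set of all (abstract) group homomorphisms $\mathbf T\to\Bbbk^*$. For $\theta\in\widehat{\mathbf T}$ let $\Bbbk_\theta$ be the corresponding one-dimensional module of $\mathbf T$, also regarded as a $\mathbf B$-module via $\mathbf B\to\mathbf T$, and put $\mathbb M(\theta)=\Bbbk\mathbf G\otimes_{\Bbbk\mathbf B}\Bbbk_\theta$. Let $\mathrm{tr}$ be the trivial character; the trivial $\Bbbk\mathbf G$-module is also denoted $\Bbbk_{\mathrm{tr}}$. The Steinberg module $\mathrm{St}$ is the submodule of $\mathbb M(\mathrm{tr})$ generated by $(1-\dot s)\mathbf 1_{\mathrm{tr}}$, where $\mathbf 1_{\mathrm{tr}}$ is a nonzero element of $\Bbbk_{\mathrm{tr}}$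 viewed in $\mathbb M(\mathrm{tr})$. For a $\Bbbk\mathbf G$-module $M$ and $\lambda\in\widehat{\mathbf T}$ let $M_\lambda=\{\xi\in M\mid t\xi=\lambda(t)\xi\ \forall t\in\mathbf T\}$, $M^{\mathbf T}=\bigoplus_{\lambda\in\widehat{\mathbf T}}M_\lambda$ and $\mathfrak d(M)=\dim M^{\mathbf T}$. A $\mathbf T$-eigenvector is an element of some $M_\lambda$. The category $\mathscr C(\mathbf G)$ is the full subcategory of the category of $\Bbbk\mathbf G$-modules whose objects are those $M$ such that $n=\mathfrak d(M)<+\infty$ and there exist $\mathbf T$-eigenvectors $\xi_1,\dots,\xi_n\in M$ with $M\cong\bigoplus_{i=1}^n\Bbbk\mathbf U\xi_i$ as $\Bbbk\mathbf B$-modules. *)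

(* Defs.v *)
From HB Require Import structures.
From mathcomp Require Import finmap monalg.
From mathcomp Require Import all_boot all_order all_algebra.
From mathcomp Require Import boolp classical_sets.

Set Implicit Arguments.
Unset Strict Implicit.
Unset Printing Implicit Defensive.

Import GRing.Theory.

Local Open Scope ring_scope.
Local Open Scope classical_set_scope.

Section LinearAlgebra.
Variables (k : fieldType) (V : lmodType k).

Definition lspan (A : set V) : set V :=
  [set x | exists n (c : 'I_n -> k) (e : 'I_n -> V),
     (forall i, A (e i)) /\ x = \sum_i c i *: e i].

Definition has_dim (W : set V) (n : nat) : Prop :=
  exists e : 'I_n -> V,
    (forall c : 'I_n -> k, \sum_i c i *: e i = 0 -> forall i, c i = 0) /\
    (forall x, W x <-> exists c : 'I_n -> k, x = \sum_i c i *: e i).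

Lemma lspan_submod (A : set V) : submod_closed [pred x | `[< lspan A x >]].
Proof.
split=> [|a x y].
  apply/asboolP; exists 0%N, (fun=> 0), (fun=> 0); split; first by case.
  by rewrite big_ord0.
move=> /asboolP[n [c [e [eA ->]]]] /asboolP[m [d [f [fA ->]]]].
apply/asboolP.
exists (n + m)%N, (fun i => match split i with inl j => a * c j | inr j => d j end),
  (fun i => match split i with inl j => e j | inr j => f j end).
split=> [i|]; first by case: (split i).
rewrite big_split_ord scaler_sumr; congr (_ + _); apply: eq_bigr => i _ /=.
  by case: split_ordP => j /eqP; rewrite ?eq_lshift ?eq_lrshift // => /eqP <-;
    rewrite scalerA.
by case: split_ordP => j /eqP; rewrite ?eq_rshift ?eq_rlshift // => /eqP <-.
Qed.

End LinearAlgebra.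

(** A [kG]-module is encoded as a [k]-vector space with a linear action of [G];
  the [kG]-linear maps are the [k]-linear maps that commute with [G]. *)

Record gmod (k : fieldType) (G : groupType) := GMod {
  gmod_sort :> lmodType k;
  gact : G -> {linear gmod_sort -> gmod_sort};
  gact1 : forall v, gact 1%g v = v;
  gactM : forall g h v, gact (g * h)%g v = gact g (gact h v) }.

Arguments gact {k G g} _ : rename.

Section GModules.
Variables (k : fieldType) (G : groupType).
Implicit Types M N : gmod k G.

Definition is_hom M N (f : {linear M -> N}) : Prop :=
  forall g v, f (gact g v) = gact g (f v).

Definition gmod_iso M N : Prop :=
  exists f : {linear M -> N}, is_hom f /\ bijective f.

Record submod M := Submod {
  sub_mem : {pred M};
  sub_closed : submod_closed sub_mem;
  sub_stable : forall g v, v \in sub_mem -> gact g v \in sub_mem }.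

HB.instance Definition _ M (S : submod M) :=
  GRing.isSubmodClosed.Build k M (sub_mem S) (sub_closed S).

Fact subsemimod_sub M (S : submod M) : GRing.subsemimod_closed (sub_mem S).
Proof. exact: GRing.submod_closed_semi (sub_closed S). Qed.

Section SubModule.
Variables (M : gmod k G) (S : submod M).

Definition sub_sort := {v : M | v \in sub_mem S}.

HB.instance Definition _ := SubChoice.on sub_sort.
HB.instance Definition _ :=
  GRing.SubChoice_isSubLmodule.Build k M (sub_mem S) sub_sort
    (subsemimod_sub S).

Definition sub_act (g : G) (v : sub_sort) : sub_sort :=
  exist _ (gact g (val v)) (sub_stable g (valP v)).

Fact sub_act_linear g : linear (sub_act g).
Proof. by move=> a u v; apply: val_inj; rewrite /= !linearP. Qed.

HB.instance Definition _ g :=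
  GRing.isLinear.Build k sub_sort sub_sort *:%R (sub_act g) (sub_act_linear g).

Fact sub_act1 v : sub_act 1%g v = v.
Proof. by apply: val_inj; rewrite /= gact1. Qed.

Fact sub_actM g h v : sub_act (g * h)%g v = sub_act g (sub_act h v).
Proof. by apply: val_inj; rewrite /= gactM. Qed.

Definition gmod_sub : gmod k G :=
  @GMod k G sub_sort (fun g => sub_act g) sub_act1 sub_actM.

End SubModule.

Section QuotientModule.
Variables (M : gmod k G) (S : submod M).
Local Open Scope quotient_scope.

Definition quo_sort := Quotient.quot (sub_mem S).

HB.instance Definition _ := GRing.Zmodule.on quo_sort.

Definition quo_pi (v : M) : quo_sort := \pi_quo_sort v.

Lemma quo_piP (u v : M) : quo_pi u = quo_pi v <-> u - v \in sub_mem S.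
Proof. by rewrite Quotient.idealrBE; split => [/eqP|/eqP]. Qed.

Lemma quo_piK (x : quo_sort) : quo_pi (repr x) = x.
Proof. exact: reprK. Qed.

Lemma quo_piD (u v : M) : quo_pi (u + v) = quo_pi u + quo_pi v.
Proof. exact: (raddfD \pi_quo_sort). Qed.

Definition quo_scale (a : k) (x : quo_sort) : quo_sort := quo_pi (a *: repr x).

Lemma quo_scaleE a v : quo_scale a (quo_pi v) = quo_pi (a *: v).
Proof.
apply/quo_piP; rewrite -scalerBr rpredZ //.
by apply/quo_piP; rewrite quo_piK.
Qed.

Fact quo_scaleA a b x : quo_scale a (quo_scale b x) = quo_scale (a * b) x.
Proof. by rewrite -[x]quo_piK !quo_scaleE scalerA. Qed.
Fact quo_scale1 : left_id 1 quo_scale.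
Proof. by move=> x; rewrite -[x]quo_piK quo_scaleE scale1r. Qed.
Fact quo_scaleDr : right_distributive quo_scale +%R.
Proof.
by move=> a x y; rewrite -[x]quo_piK -[y]quo_piK -quo_piD !quo_scaleE scalerDr quo_piD.
Qed.
Fact quo_scaleDl x : {morph quo_scale^~ x : a b / a + b}.
Proof. by move=> a b; rewrite -[x]quo_piK !quo_scaleE scalerDl quo_piD. Qed.

HB.instance Definition _ := GRing.Zmodule_isLmodule.Build k quo_sort
  quo_scaleA quo_scale1 quo_scaleDr quo_scaleDl.

Lemma quo_pi_linear : linear quo_pi.
Proof. by move=> a u v; rewrite quo_piD -quo_scaleE. Qed.

HB.instance Definition _ :=
  GRing.isLinear.Build k M quo_sort *:%R quo_pi quo_pi_linear.

Definition quo_act (g : G) (x : quo_sort) : quo_sort := quo_pi (gact g (repr x)).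

Lemma quo_actE g v : quo_act g (quo_pi v) = quo_pi (gact g v).
Proof.
apply/quo_piP; rewrite -linearB sub_stable //.
by apply/quo_piP; rewrite quo_piK.
Qed.

Fact quo_act_linear g : linear (quo_act g).
Proof.
move=> a x y; rewrite -[x]quo_piK -[y]quo_piK -linearP !quo_actE.
by rewrite -linearP -linearP.
Qed.

HB.instance Definition _ g :=
  GRing.isLinear.Build k quo_sort quo_sort *:%R (quo_act g) (quo_act_linear g).

Fact quo_act1 x : quo_act 1%g x = x.
Proof. by rewrite -[x]quo_piK quo_actE gact1. Qed.

Fact quo_actM g h x : quo_act (g * h)%g x = quo_act g (quo_act h x).
Proof. by rewrite -[x]quo_piK !quo_actE gactM. Qed.

Definition gmod_quo : gmod k G :=
  @GMod k G quo_sort (fun g => quo_act g) quo_act1 quo_actM.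

End QuotientModule.

Definition orbits M (A : set M) : set M :=
  [set x | exists g a, A a /\ x = gact g a].

Fact gspan_stable M (A : set M) g v :
  v \in [pred x | `[< lspan (orbits A) x >]] ->
  gact g v \in [pred x | `[< lspan (orbits A) x >]].
Proof.
move=> /asboolP[n [c [e [eA ->]]]]; apply/asboolP.
exists n, c, (fun i => gact g (e i)); split.
  by move=> i; have [h [a [Aa ->]]] := eA i; exists (g * h)%g, a; rewrite gactM.
by rewrite linear_sum; apply: eq_bigr => i _; rewrite linearZ.
Qed.

Definition gspan M (A : set M) : submod M :=
  Submod (lspan_submod (orbits A)) (@gspan_stable M A).

Section Power.
Variables (n : nat) (M : gmod k G).

Definition pow_act (g : G) (x : {ffun 'I_n -> M}) : {ffun 'I_n -> M} :=
  [ffun i => gact g (x i)].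

Fact pow_act_linear g : linear (pow_act g).
Proof. by move=> a x y; apply/ffunP => i; rewrite !ffunE linearP. Qed.

HB.instance Definition _ g :=
  GRing.isLinear.Build k {ffun 'I_n -> M} {ffun 'I_n -> M} *:%R
    (pow_act g) (pow_act_linear g).

Fact pow_act1 x : pow_act 1%g x = x.
Proof. by apply/ffunP => i; rewrite !ffunE gact1. Qed.

Fact pow_actM g h x : pow_act (g * h)%g x = pow_act g (pow_act h x).
Proof. by apply/ffunP => i; rewrite !ffunE gactM. Qed.

Definition gmod_pow : gmod k G :=
  @GMod k G {ffun 'I_n -> M} (fun g => pow_act g) pow_act1 pow_actM.

End Power.

End GModules.

Lemma mult1 (G H : groupType) (f : {multiplicative G -> H}) : f 1%g = 1%g.
Proof. by apply: (mulgI (f 1%g)); rewrite -gmulfM !mulg1. Qed.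

Section Restriction.
Variables (k : fieldType) (H G : groupType) (f : {multiplicative H -> G}).
Variable M : gmod k G.

Fact res_act1 (v : M) : gact (f 1%g) v = v.
Proof. by rewrite mult1 gact1. Qed.

Fact res_actM g h (v : M) : gact (f (g * h)%g) v = gact (f g) (gact (f h) v).
Proof. by rewrite gmulfM gactM. Qed.

Definition gmod_res : gmod k H :=
  @GMod k H M (fun h => gact (f h)) res_act1 res_actM.

End Restriction.

Section Induction.
Variables (k : fieldType) (H G : groupType) (f : {multiplicative H -> G}).
Variable V : gmod k H.

(** [kG (x)_k V] is realized as the space of finitely supported functions from
  [G] to [V]: [<< v *g x >>] is the pure tensor [x (x) v]. *)
Definition gtens := {malg V[G]}.

HB.instance Definition _ := GRing.Zmodule.on gtens.

Definition tens (x : G) (v : V) : gtens := << v *g x >>.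

Definition gtens_scale (a : k) (t : gtens) : gtens :=
  \sum_(x <- msupp t) tens x (a *: mcoeff x t).

Lemma gtens_scaleE a t x : mcoeff x (gtens_scale a t) = a *: mcoeff x t.
Proof.
rewrite [in RHS](monalgE t) /gtens_scale !raddf_sum /=.
by apply: eq_bigr => y _; rewrite !mcoeffU scalerMnr.
Qed.

Fact gtens_scaleA a b t : gtens_scale a (gtens_scale b t) = gtens_scale (a * b) t.
Proof. by apply/malgP => x; rewrite !gtens_scaleE scalerA. Qed.
Fact gtens_scale1 : left_id 1 gtens_scale.
Proof. by move=> t; apply/malgP => x; rewrite gtens_scaleE scale1r. Qed.
Fact gtens_scaleDr : right_distributive gtens_scale +%R.
Proof.
by move=> a s t; apply/malgP => x; rewrite !(mcoeffD, gtens_scaleE) scalerDr.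
Qed.
Fact gtens_scaleDl t : {morph gtens_scale^~ t : a b / a + b}.
Proof.
by move=> a b; apply/malgP => x; rewrite !(mcoeffD, gtens_scaleE) scalerDl.
Qed.

HB.instance Definition _ := GRing.Zmodule_isLmodule.Build k gtens
  gtens_scaleA gtens_scale1 gtens_scaleDr gtens_scaleDl.

Definition gtens_act (g : G) (t : gtens) : gtens :=
  \sum_(x <- msupp t) tens (g * x)%g (mcoeff x t).

Lemma gtens_actE g t x : mcoeff x (gtens_act g t) = mcoeff (g^-1 * x)%g t.
Proof.
rewrite [in RHS](monalgE t) /gtens_act !raddf_sum /=.
apply: eq_bigr => y _; rewrite !mcoeffU; congr (_ *+ nat_of_bool _).
by apply/eqP/eqP => [<-|->]; rewrite ?mulKg ?mulVKg.
Qed.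

Fact gtens_act_linear g : linear (gtens_act g).
Proof.
move=> a s t; apply/malgP => x.
by rewrite gtens_actE !(mcoeffD, gtens_scaleE) !gtens_actE.
Qed.

HB.instance Definition _ g :=
  GRing.isLinear.Build k gtens gtens *:%R (gtens_act g) (gtens_act_linear g).

Fact gtens_act1 t : gtens_act 1%g t = t.
Proof. by apply/malgP => x; rewrite gtens_actE invg1 mul1g. Qed.

Fact gtens_actM g h t : gtens_act (g * h)%g t = gtens_act g (gtens_act h t).
Proof. by apply/malgP => x; rewrite !gtens_actE invgM mulgA. Qed.

Definition gmod_tens : gmod k G :=
  @GMod k G gtens (fun g => gtens_act g) gtens_act1 gtens_actM.

(** The relations [x h (x) v = x (x) h v]; they form a [G]-stable set, so the
  submodule they generate is their linear span. *)
Definition balanced : set gmod_tens :=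
  [set t | exists x h v, t = tens (x * f h)%g v - tens x (gact h v)].

(** The tensor product [kG (x)_(kH) V], where [kH] acts through [f]. *)
Definition gmod_ind : gmod k G := gmod_quo (gspan balanced).

Definition ind_tens (x : G) (v : V) : gmod_ind := quo_pi (gspan balanced) (tens x v).

End Induction.

Definition units (k : fieldType) := {x : k | x != 0}.

Section Units.
Variable k : fieldType.

HB.instance Definition _ := SubChoice.on (units k).

Definition units_one : units k := exist _ 1 (oner_neq0 k).
Definition units_mul (x y : units k) : units k :=
  exist _ (val x * val y) (mulf_neq0 (valP x) (valP y)).
Fact units_inv_subproof (x : units k) : (val x)^-1 != 0.
Proof. by rewrite invr_eq0 (valP x). Qed.
Definition units_inv (x : units k) : units k := exist _ (val x)^-1 (units_inv_subproof x).

Fact units_mulA : associative units_mul.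
Proof. by move=> x y z; apply: val_inj; rewrite /= mulrA. Qed.
Fact units_mul1 : left_id units_one units_mul.
Proof. by move=> x; apply: val_inj; rewrite /= mul1r. Qed.
Fact units_mulr1 : right_id units_one units_mul.
Proof. by move=> x; apply: val_inj; rewrite /= mulr1. Qed.
Fact units_mulV : left_inverse units_one units_inv units_mul.
Proof. by move=> x; apply: val_inj; rewrite /= mulVf // (valP x). Qed.
Fact units_mulrV : right_inverse units_one units_inv units_mul.
Proof. by move=> x; apply: val_inj; rewrite /= mulfV // (valP x). Qed.

HB.instance Definition _ := isGroup.Build (units k)
  units_mulA units_mul1 units_mulr1 units_mulV units_mulrV.

End Units.

Section CharacterModule.
Variables (k : fieldType) (G : groupType) (chi : {multiplicative G -> units k}).

Definition char_act (g : G) (v : k^o) : k^o := val (chi g) *: v.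

Fact char_act_linear g : linear (char_act g).
Proof. by move=> a u v; rewrite /char_act scalerDr !scalerA mulrC. Qed.

HB.instance Definition _ g :=
  GRing.isLinear.Build k k^o k^o *:%R (char_act g) (char_act_linear g).

Fact char_act1 v : char_act 1%g v = v.
Proof. by rewrite /char_act mult1 scale1r. Qed.

Fact char_actM g h v : char_act (g * h)%g v = char_act g (char_act h v).
Proof. by rewrite /char_act gmulfM scalerA. Qed.

Definition gmod_char : gmod k G :=
  @GMod k G k^o (fun g => char_act g) char_act1 char_actM.

End CharacterModule.

Definition triv_char (k : fieldType) (G : groupType) : {multiplicative G -> units k} :=
  one_fun (units k).

(** A full subcategory of the category of [kG]-modules is given by the predicate
  [C] on objects. Monomorphisms are those of this subcategory: they are tested
  against objects of [C] only, and are not assumed to be injective. *)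
Section Categories.
Variables (k : fieldType) (G : groupType) (C : gmod k G -> Prop).

(** [f] is assumed to be a morphism between objects of [C]. *)
Definition mono_in (N M : gmod k G) (f : {linear N -> M}) : Prop :=
  forall X : gmod k G, C X -> forall g h : {linear X -> N}, is_hom g -> is_hom h ->
    (forall x, f (g x) = f (h x)) -> forall x, g x = h x.

(** A nonzero object all of whose monomorphisms from [C] are zero or invertible;
  the inverse of a bijective [kG]-linear map is [kG]-linear. *)
Definition simple_in (M : gmod k G) : Prop :=
  [/\ C M, exists v : M, v <> 0 &
      forall N : gmod k G, C N -> forall f : {linear N -> M}, is_hom f -> mono_in f ->
        (forall x, f x = 0) \/ bijective f].

End Categories.

Section SL2Group.
Variable F : fieldType.

Record SL2 := MkSL2 { sl2_mx :> 'M[F]_2; sl2_det : \det sl2_mx == 1 }.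

HB.instance Definition _ := [isSub for sl2_mx].
HB.instance Definition _ := [Choice of SL2 by <:].

Fact sl2_mul_subproof (g h : SL2) : \det (sl2_mx g *m sl2_mx h) == 1.
Proof. by rewrite det_mulmx (eqP (sl2_det g)) (eqP (sl2_det h)) mulr1. Qed.
Fact sl2_one_subproof : \det (1%:M : 'M[F]_2) == 1.
Proof. by rewrite det1. Qed.
Fact sl2_inv_subproof (g : SL2) : \det (invmx (sl2_mx g)) == 1.
Proof. by rewrite det_inv (eqP (sl2_det g)) invr1. Qed.

Definition sl2_mul g h := MkSL2 (sl2_mul_subproof g h).
Definition sl2_one := MkSL2 sl2_one_subproof.
Definition sl2_inv g := MkSL2 (sl2_inv_subproof g).

Lemma sl2_unitmx (g : SL2) : sl2_mx g \in unitmx.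
Proof. by rewrite unitmxE (eqP (sl2_det g)) unitr1. Qed.

Fact sl2_mulA : associative sl2_mul.
Proof. by move=> x y z; apply: val_inj; rewrite /= mulmxA. Qed.
Fact sl2_mul1 : left_id sl2_one sl2_mul.
Proof. by move=> x; apply: val_inj; rewrite /= mul1mx. Qed.
Fact sl2_mulr1 : right_id sl2_one sl2_mul.
Proof. by move=> x; apply: val_inj; rewrite /= mulmx1. Qed.
Fact sl2_mulV : left_inverse sl2_one sl2_inv sl2_mul.
Proof. by move=> x; apply: val_inj; rewrite /= mulVmx ?sl2_unitmx. Qed.
Fact sl2_mulrV : right_inverse sl2_one sl2_inv sl2_mul.
Proof. by move=> x; apply: val_inj; rewrite /= mulmxV ?sl2_unitmx. Qed.

HB.instance Definition _ := isGroup.Build SL2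
  sl2_mulA sl2_mul1 sl2_mulr1 sl2_mulV sl2_mulrV.

Lemma sl2_mulE (g h : SL2) i j :
  (g * h)%g i j = g i 0 * h 0 j + g i 1 * h 1 j.
Proof.
rewrite /= mxE !big_ord_recl big_ord0 addr0.
by have -> : lift ord0 ord0 = 1 :> 'I_2 by apply: val_inj.
Qed.

Lemma sl2_oneE i j : (1%g : SL2) i j = (i == j)%:R.
Proof. by rewrite /= mxE. Qed.

Lemma det22 (A : 'M[F]_2) : \det A = A 0 0 * A 1 1 - A 0 1 * A 1 0.
Proof.
rewrite (expand_det_row _ ord0) !big_ord_recl big_ord0 addr0 /cofactor !det_mx11 !mxE /=.
rewrite expr0 expr1 mul1r mulN1r mulrN.
by congr (A _ _ * A _ _ - A _ _ * A _ _); apply: val_inj.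
Qed.

Lemma sl2_detE (g : SL2) : g 0 0 * g 1 1 - g 0 1 * g 1 0 = 1.
Proof. by rewrite -det22 (eqP (sl2_det g)). Qed.

Lemma sl2_invE (g : SL2) :
  [/\ (g^-1)%g 0 0 = g 1 1, (g^-1)%g 0 1 = - g 0 1,
      (g^-1)%g 1 0 = - g 1 0 & (g^-1)%g 1 1 = g 0 0].
Proof.
have E i j : (g^-1)%g i j = cofactor (sl2_mx g) j i.
  by rewrite /= /invmx sl2_unitmx (eqP (sl2_det g)) invr1 scale1r mxE.
rewrite !E /cofactor !det_mx11 !mxE /= !(expr0, expr1, addn0, add0n, mul1r, mulN1r).
rewrite sqrrN expr1n mul1r; split; do ?[congr (- _)]; congr (sl2_mx g _ _); exact: val_inj.
Qed.

Definition is_borel : {pred SL2} := [pred g : SL2 | g 1 0 == 0].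
Definition is_torus : {pred SL2} := [pred g : SL2 | (g 0 1 == 0) && (g 1 0 == 0)].
Definition is_unip : {pred SL2} :=
  [pred g : SL2 | [&& g 0 0 == 1, g 1 1 == 1 & g 1 0 == 0]].

Lemma is_borelE g : (g \in is_borel) = (g 1 0 == 0). Proof. by []. Qed.
Lemma is_torusE g : (g \in is_torus) = (g 0 1 == 0) && (g 1 0 == 0). Proof. by []. Qed.
Lemma is_unipE g : (g \in is_unip) = [&& g 0 0 == 1, g 1 1 == 1 & g 1 0 == 0].
Proof. by []. Qed.

Fact borel_closed : group_closed is_borel.
Proof.
split=> [|g h]; rewrite !is_borelE ?sl2_oneE ?eqxx //.
have [_ _ h10 h11] := sl2_invE h.
by move=> /eqP g10 /eqP h10'; rewrite sl2_mulE h10 h10' g10 oppr0 mul0r mulr0 addr0.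
Qed.

Fact torus_closed : group_closed is_torus.
Proof.
split=> [|g h]; rewrite !is_torusE ?sl2_oneE ?eqxx //.
have [h00 h01 h10 h11] := sl2_invE h.
move=> /andP[/eqP g01 /eqP g10] /andP[/eqP h01' /eqP h10'].
by rewrite !sl2_mulE h01 h10 h01' h10' g10 g01 !(oppr0, mul0r, mulr0, addr0) eqxx.
Qed.

Fact unip_closed : group_closed is_unip.
Proof.
split=> [|g h]; rewrite !is_unipE ?sl2_oneE ?eqxx //.
have [h00 h01 h10 h11] := sl2_invE h.
move=> /and3P[/eqP g00 /eqP g11 /eqP g10] /and3P[/eqP h00' /eqP h11' /eqP h10'].
rewrite !sl2_mulE h00 h01 h10 h11 h00' h10' h11' g10 g00 g11.
by rewrite !(oppr0, mul0r, mulr0, addr0, add0r, mulr1) !eqxx.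
Qed.

Definition borel := {g : SL2 | g \in is_borel}.
Definition torus := {g : SL2 | g \in is_torus}.
Definition unip := {g : SL2 | g \in is_unip}.

HB.instance Definition _ := SubChoice.on borel.
HB.instance Definition _ :=
  SubChoice_isSubGroup.Build SL2 is_borel borel borel_closed.
HB.instance Definition _ := SubChoice.on torus.
HB.instance Definition _ :=
  SubChoice_isSubGroup.Build SL2 is_torus torus torus_closed.
HB.instance Definition _ := SubChoice.on unip.
HB.instance Definition _ :=
  SubChoice_isSubGroup.Build SL2 is_unip unip unip_closed.

Definition borel_incl : {multiplicative borel -> SL2} := val.

Definition diag_part (g : SL2) : 'M[F]_2 :=
  \matrix_(i, j) (if i == j then g i i else 0).

Fact diag_part_det (b : borel) : \det (diag_part (val b)) == 1.
Proof.
have /eqP b10 := valP b.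
by rewrite det22 !mxE /= mul0r subr0 -[X in _ == X](sl2_detE (val b)) b10 mulr0 subr0.
Qed.

Fact diag_part_torus (b : borel) : MkSL2 (diag_part_det b) \in is_torus.
Proof. by rewrite inE /= !mxE /= eqxx. Qed.

Definition borel_torus (b : borel) : torus :=
  exist (fun g => g \in is_torus) (MkSL2 (diag_part_det b)) (diag_part_torus b).

Fact borel_torusM : {morph borel_torus : b c / (b * c)%g}.
Proof.
have ord2 (i : 'I_2) : i = 0 \/ i = 1.
  by case: i => [[|[|//]] ?]; [left | right]; apply: val_inj.
have E (b : borel) i j : val (borel_torus b) i j = if i == j then val b i i else 0.
  exact: mxE.
move=> b c; apply/val_inj/val_inj/matrixP => i j.
have /eqP b10 := valP b; have /eqP c10 := valP c.
rewrite [LHS]E [RHS](sl2_mulE (val (borel_torus b)) (val (borel_torus c))) !E.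
rewrite (sl2_mulE (val b) (val c)).
have [-> | ->] := ord2 i; have [-> | ->] := ord2 j; rewrite /= ?b10 ?c10.
all: by rewrite !(mulr0, mul0r, addr0).
Qed.

HB.instance Definition _ := isMultiplicative.Build borel torus borel_torus borel_torusM.

Definition weyl_mx : 'M[F]_2 :=
  \matrix_(i, j) (if i == j then 0 else if i == 0 then 1 else -1).

Fact weyl_det : \det weyl_mx == 1.
Proof. by rewrite det22 !mxE /= mul0r mulrN1 sub0r opprK. Qed.

Definition weyl : SL2 := MkSL2 weyl_det.

End SL2Group.

Section SL2Modules.
Variables (k F : fieldType).

Local Notation G := (SL2 F).
Local Notation T := (torus F).
Local Notation B := (borel F).
Local Notation U := (unip F).

(** [M(theta)]: the character [theta] of [T] is inflated along [B -> T] and then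
  induced from [B] to [G]. *)
Definition M_theta (theta : {multiplicative T -> units k}) : gmod k G :=
  gmod_ind (@borel_incl F) (gmod_res (@borel_torus F) (gmod_char theta)).

Definition M_tr : gmod k G := M_theta (triv_char k T).

Definition k_tr : gmod k G := gmod_char (triv_char k G).

Definition one_tr : M_tr :=
  @ind_tens k B G (@borel_incl F) (gmod_res (@borel_torus F) (gmod_char (triv_char k T)))
    1%g (1 : k^o).

Definition St : gmod k G :=
  gmod_sub (gspan [set (one_tr - gact (weyl F) one_tr : M_tr)]).

Section CategoryC.
Variable M : gmod k G.

Definition weight_space (lambda : {multiplicative T -> units k}) : set M :=
  [set v | forall t : T, gact (val t) v = val (lambda t) *: v].

Definition eigenvector (v : M) : Prop := exists lambda, weight_space lambda v.

(** The span of all weight spaces, that is, their sum; this sum is direct since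
  eigenvectors with distinct weights are linearly independent. *)
Definition torus_part : set M := lspan eigenvector.

Definition unip_span (v : M) : set M := lspan [set gact (val u) v | u in [set: U]].

(** An isomorphism of [kB]-modules from [M] to the external direct sum of the
  [kU (xi i)] is given as a [B]-linear injection of [M] into [M ^ n] whose image
  is the product of the [kU (xi i)]. *)
Definition in_C : Prop :=
  exists n : nat, has_dim torus_part n /\
    exists xi : 'I_n -> M, (forall i, eigenvector (xi i)) /\
      exists phi : {linear gmod_res (@borel_incl F) M ->
                           gmod_pow n (gmod_res (@borel_incl F) M)},
        [/\ is_hom phi, injective phi &
            forall x : {ffun 'I_n -> M},
              (exists v, phi v = x) <-> (forall i, unip_span (xi i) (x i))].

End CategoryC.

End SL2Modules.

(* Main.v *)
From HB Require Import structures.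
Require Import Defs.
From mathcomp Require Import finmap monalg.
From mathcomp Require Import all_boot all_algebra finfield.
From mathcomp Require Import boolp.
From mathcomp Require Import ring.

Set Implicit Arguments.
Unset Strict Implicit.
Unset Printing Implicit Defensive.

Import GRing.Theory.

Local Open Scope ring_scope.

(** Throughout, [u_x], [h_d] and [s] are the unipotent, torus and Weyl elements, acting
  on a module by [U x], [T d] and [S]; [U] is also the unipotent group.

  The listed modules are irreducible as plain modules, and this rests on one
  fact about the additive group of the algebraic closure [F] of a finite field:
  an ideal of its group algebra that is stable under the dilations of [F] and
  nonzero contains the augmentation ideal ([augmentation_ideal]). So a nonzero
  submodule of a principal series or of the Steinberg module contains all
  differences of the points of the open Bruhat cell, and applying [s] to these
  recovers the generator ([principal_irreducible], [steinberg_irreducible]).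

  Everything else is a statement about an arbitrary object [N] of the category:
  every nonzero submodule [K] of [N] receives a nonzero map from a listed module
  ([listed_maps]). This gives both directions. A simple object receives a
  nonzero map from a listed module, which is injective by irreducibility, hence
  a monomorphism, hence bijective. Conversely, if [f : N -> M] is a nonzero
  monomorphism of the category into a module isomorphic to a listed one, a nonzero kernel
  would receive a nonzero map from an object of the category, against [f] being
  mono; so [f] is injective, and it is onto by irreducibility.

  For [listed_maps], the ideal theorem first shows that each summand [kU xi] of
  [N] is free over [kU] or fixed by [U] ([in_C_cells]). If [K] contains a vector
  fixed by [U], it contains one that is also a torus eigenvector, and Frobenius
  reciprocity applies. Otherwise the point is to know how [s] acts on [N] modulo
  the vectors fixed by [U]. Comparing the two sides of
  [s u_x s u_1 = u_(-1/x) s h u_(1-1/x)] for generic [x] shows that [s u_1 v] is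
  supported at the points [0] and [-1] of the cell ([Cf_eq0]); the coefficient
  at [-1] yields an additive one-parameter group of matrices normalized by the
  torus, which is trivial by the ideal theorem again ([conj_additive_trivial]),
  since the characteristic of [k] is zero. Hence every eigenvector behaves as in
  a principal series ([weyl_eig]). An eigenvector of [K] can now be found, and
  the same relation forces it to generate a copy of the Steinberg module
  ([steinberg_vector]). *)

(** * Finite subfields of the algebraic closure of a finite field *)

(** Finite subfields are duplicate-free lists, so that one can sum over them. *)
Definition finite_subfield (F : fieldType) (E : seq F) : Prop :=
  [/\ uniq E, 1 \in E, {in E &, forall x y, x - y \in E},
      {in E &, forall x y, x * y \in E} & {in E, forall x, x^-1 \in E}].

Definition locally_finite (F : fieldType) : Prop :=
  forall s : seq F, exists2 E, finite_subfield E & {subset s <= E}.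

Section FiniteSubfields.
Variable F : closedFieldType.

Lemma poly_roots_seq (q : {poly F}) : q != 0 ->
  exists2 r : seq F, uniq r & forall x, (x \in r) = root q x.
Proof.
move=> q0; have [r Dq] := closed_field_poly_normal q.
exists (undup r); first exact: undup_uniq.
by move=> x; rewrite mem_undup Dq rootZ ?lead_coef_eq0 // root_prod_XsubC.
Qed.

Lemma notin_seq (s : seq F) : exists x, x \notin s.
Proof.
have /closed_nonrootP[x nx] : \prod_(a <- s) ('X - a%:P) != 0.
  by rewrite monic_neq0 // monic_prod_XsubC.
by exists x; rewrite -root_prod_XsubC.
Qed.

Lemma nonroot_seq (q : {poly F}) (s : seq F) : q != 0 ->
  exists2 x, ~~ root q x & x \notin s.
Proof.
move=> q0; have [r _ Dr] := poly_roots_seq q0.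
have [x] := notin_seq (r ++ s); rewrite mem_cat negb_or Dr => /andP[].
by exists x.
Qed.

Lemma exists_sqrt (x : F) : exists y : F, y ^+ 2 = x.
Proof.
have [y Dy] := @solve_monicpoly F 2 (fun i => if i == 0%N then x else 0) isT.
by exists y; rewrite Dy !big_ord_recl big_ord0 /= expr0 mulr1 mul0r !addr0.
Qed.

Lemma exists_sqrt_neq0 (x : F) : x != 0 -> exists2 y : F, y != 0 & y ^+ 2 = x.
Proof.
move=> x0; have [y Dy] := exists_sqrt x; exists y => //.
by apply: contra_neq x0 => y0; rewrite -Dy y0 expr0n.
Qed.

Variables (Fq : finFieldType) (iota : {rmorphism Fq -> F}).
Hypothesis algF : forall x : F, algebraicOver iota x.

Let p := s2val (finPcharP Fq).
Let p_pr : prime p := s2valP (finPcharP Fq).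

Let charF : p \in [pchar F].
Proof. by apply: (rmorph_pchar iota); exact: s2valP' (finPcharP Fq). Qed.

Let pnat_exp N : [pchar F].-nat (p ^ N)%N.
Proof. by rewrite (eq_pnat _ (pcharf_eq charF)) pnatX pnat_id. Qed.

Let frobB N (x y : F) : (x - y) ^+ (p ^ N) = x ^+ (p ^ N) - y ^+ (p ^ N).
Proof.
apply/eqP; rewrite eq_sym subr_eq -exprDn_pchar ?pnat_exp //.
by rewrite subrK.
Qed.

(** The powers of [x] under iterates of Frobenius lie in the finite ring
  [Fq[x]], so two of them agree; Frobenius is injective. *)
Let frob_periodic (x : F) : exists2 m, (0 < m)%N & x ^+ (p ^ m) = x.
Proof.
have [P P0 Px] := algF x.
pose d := (size P).-1.
have Pgt0 : (0 < size P)%N by rewrite size_poly_gt0.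
pose f (i : nat) : 'rV[Fq]_d := poly_rV ('X^(p ^ i) %% P).
have fE i : (map_poly iota (rVpoly (f i))).[x] = x ^+ (p ^ i).
  rewrite poly_rV_K; last by rewrite -ltnS prednK // ltn_modp.
  have /(congr1 (map_poly iota)) := divp_eq 'X^(p ^ i) P.
  rewrite rmorphD rmorphM /= map_polyXn => /(congr1 (horner^~ x)) /=.
  by rewrite hornerXn hornerD hornerM (rootP Px) mulr0 add0r => <-.
pose g (i : 'I_(#|{: 'rV[Fq]_d}|.+1)) := f i.
have /injectivePn[i [j nij gij]] : ~~ injectiveb g.
  apply/negP => /injectiveP /leq_card; rewrite card_ord.
  by rewrite ltnn.
wlog ltij : i j nij gij / (i < j)%N.
  move=> W; have [/W|/W|/val_inj E] := ltngtP i j; first exact.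
    by apply; rewrite 1?eq_sym.
  by rewrite E eqxx in nij.
exists (j - i)%N; first by rewrite subn_gt0.
have E : x ^+ (p ^ i) = x ^+ (p ^ j) by rewrite -!fE [f i]gij.
apply/eqP; rewrite -subr_eq0; suff : (x ^+ (p ^ (j - i)) - x) ^+ (p ^ i) == 0.
  by rewrite expf_eq0 => /andP[].
by rewrite frobB -exprM -expnD subnK ?(ltnW ltij) // E subrr.
Qed.

Lemma frob_mul (x : F) m N : x ^+ (p ^ m) = x -> x ^+ (p ^ (m * N)) = x.
Proof.
move=> xm; elim: N => [|N IH]; first by rewrite muln0 expr1.
by rewrite mulnS expnD exprM xm IH.
Qed.

Lemma finite_subfields : locally_finite F.
Proof.
move=> s.
have [N N0 sN] : exists2 N, (0 < N)%N & {in s, forall x, x ^+ (p ^ N) = x}.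
  elim: s => [|x s [N N0 sN]]; first by exists 1%N.
  have [m m0 xm] := frob_periodic x.
  exists (m * N)%N; first by rewrite muln_gt0 m0.
  by move=> y; rewrite inE => /predU1P[->|/sN]; [|rewrite mulnC]; exact: frob_mul.
have p1 : (1 < p ^ N)%N by rewrite -(exp1n N) ltn_exp2r // prime_gt1.
have q0 : 'X^(p ^ N) - 'X != 0 :> {poly F}.
  by rewrite -size_poly_gt0 size_polyDl size_polyXn // size_polyN size_polyX.
have [E uE ME] := poly_roots_seq q0.
have {}ME x : (x \in E) = (x ^+ (p ^ N) == x).
  by rewrite ME rootE !hornerE subr_eq0.
exists E; last by move=> x xs; rewrite ME sN.
split=> // [|x y|x y|x]; rewrite !ME.
- by rewrite expr1n.
- by move=> /eqP xE /eqP yE; rewrite frobB xE yE.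
- by move=> /eqP xE /eqP yE; rewrite exprMn xE yE.
- by move=> /eqP xE; rewrite exprVn xE.
Qed.

End FiniteSubfields.

(** * Scaling-stable ideals of the group algebra of the additive group *)

(** A list of pairs stands for an element of the group algebra of [F], or of a free
  module over it; a point may occur several times. *)
Definition lcoef (F : fieldType) (V : nmodType) (l : seq (F * V)) (y : F) : V :=
  \sum_(p <- l | p.1 == y) p.2.

Definition lsum (F : fieldType) (k : fieldType) (W : lmodType k) (Q : F -> W)
  (l : seq (F * k)) : W := \sum_(p <- l) p.2 *: Q p.1.

Section AugmentationIdeal.
Variables (k : fieldType) (char0 : [pchar k] =i pred0).
Variables (F : closedFieldType) (finF : locally_finite F).

(** In characteristic zero the multiples [n%:R * a] are distinct, so at most one
  cardinality is excluded. *)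
Lemma large_subfield (a b : k) (s : seq F) : a != 0 ->
  exists E, [/\ finite_subfield E, {subset s <= E} & (size E)%:R * a != b].
Proof.
move=> a0; have [E fE sE] := finF s.
have [Eb|?] := eqVneq ((size E)%:R * a) b; last by exists E.
have [x xE] := notin_seq E.
have [E' fE' sE'] := finF (x :: E).
exists E'; split=> // [y /sE yE|]; first by rewrite sE' // inE yE orbT.
have ltE : (size E < size E')%N.
  apply: (@uniq_leq_size _ (x :: E)) => //=.
  by rewrite xE; case: fE.
rewrite -Eb -subr_eq0 -mulrBl mulf_neq0 // -natrB ?(ltnW ltE) //.
by rewrite (pcharf0P k).1 // -lt0n subn_gt0.
Qed.

Lemma subfield0 (E : seq F) : finite_subfield E -> 0 \in E.
Proof. by case=> _ E1 EB _ _; rewrite -(subrr 1) EB. Qed.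

Lemma subfieldD (E : seq F) : finite_subfield E -> {in E &, forall x y, x + y \in E}.
Proof.
move=> fE x y xE yE; have E0 := subfield0 fE; case: fE => _ _ EB _ _.
by rewrite -[y]opprK EB // -[- y]sub0r EB.
Qed.

Lemma sum_subfield_scale (E : seq F) (W : zmodType) (Q : F -> W) (x : F) :
    finite_subfield E -> x \in E -> x != 0 ->
  \sum_(t <- E) Q (t * x) = \sum_(t <- E) Q t.
Proof.
move=> [uE _ _ EM EV] xE x0.
rewrite -(big_map (fun t => t * x) predT Q); apply: perm_big.
apply: uniq_perm => // [|y].
  by rewrite map_inj_uniq // => a b /(mulIf x0).
apply/mapP/idP => [[t tE ->]|yE]; first exact: EM.
by exists (y / x); rewrite ?mulfVK // EM // EV.
Qed.

Lemma sum_subfield_shift (E : seq F) (W : zmodType) (Q : F -> W) (x : F) :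
    finite_subfield E -> x \in E ->
  \sum_(t <- E) Q (t + x) = \sum_(t <- E) Q t.
Proof.
move=> fE xE; have ED := subfieldD fE; case: fE => uE _ EB _ _.
rewrite -(big_map (fun t => t + x) predT Q); apply: perm_big.
apply: uniq_perm => // [|y].
  by rewrite map_inj_uniq // => a b /addIr.
apply/mapP/idP => [[t tE ->]|yE]; first exact: ED.
by exists (y - x); rewrite ?subrK // EB.
Qed.

Variables (W : lmodType k) (Q : F -> W) (K : {pred W}).
Hypothesis subK : submod_closed K.
Hypothesis shiftK : forall l y,
  lsum Q l \in K -> lsum (fun x => Q (x + y)) l \in K.
Hypothesis scaleK : forall l t,
  t != 0 -> lsum Q l \in K -> lsum (fun x => Q (t * x)) l \in K.

Let K0 : 0 \in K. Proof. by case: subK. Qed.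
Let KD u v : u \in K -> v \in K -> u + v \in K.
Proof. by move=> uK vK; rewrite -[u]scale1r; case: subK => _; apply. Qed.
Let KZ a u : u \in K -> a *: u \in K.
Proof. by move=> uK; rewrite -[_ *: _]addr0; case: subK => _; apply. Qed.
Let KB u v : u \in K -> v \in K -> u - v \in K.
Proof. by move=> uK vK; rewrite -scaleN1r; apply: KD => //; apply: KZ. Qed.

(** Averaging a relation over the dilations by a finite subfield [E] turns it
  into [A Q(0) + b * sum_E Q], where [A] is nonzero as soon as [E] is large;
  the second term is invariant under translation by [E]. *)
Lemma augmentation_ideal l y z : lcoef l y != 0 -> lsum Q l \in K ->
  Q z - Q 0 \in K.
Proof.
wlog y0 : l y / y = 0.
  move=> wl ly lK; apply: (wl [seq (p.1 - y, p.2) | p <- l] 0) => //.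
    rewrite /lcoef big_map; under eq_bigl do rewrite /= subr_eq0; exact: ly.
  by rewrite /lsum big_map /=; apply: (@shiftK l (- y)).
rewrite {y}y0 => l0 lK.
(* The choice of the size of [E] makes [A] below nonzero. *)
have [E [fE sE nE]] := large_subfield (\sum_(p <- l) p.2) (z :: unzip1 l) l0.
have E0 := subfield0 fE; have uE : uniq E by case: fE.
have zE : z \in E by rewrite sE ?mem_head.
set N := \sum_(x <- E) Q x.
pose b := \sum_(p <- l | p.1 != 0) p.2.
pose A := (size E)%:R * lcoef l 0 - \sum_(p <- l) p.2.
(* The sum of the dilates of [l] by the nonzero elements of [E] has the
   coefficient [b] at every point of [E], except for an excess [A] at [0]. *)
pose lE := (0, A) :: [seq (x, b) | x <- E].
have lEQ (y : F) : y \in E -> lsum (fun x => Q (x + y)) lE = A *: Q y + b *: N.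
  move=> yE; rewrite /lsum big_cons big_map /= add0r -scaler_sumr.
  by rewrite sum_subfield_shift.
have sumE (c : k) (x : F) : x \in E -> \sum_(t <- E) c *: Q (t * x) =
    if x == 0 then ((size E)%:R * c) *: Q 0 else c *: N.
  move=> xE; rewrite -scaler_sumr; case: eqP => [->|/eqP x0].
    under eq_bigr do rewrite mulr0.
    by rewrite big_const_seq count_predT iter_addr addr0 -scalerMnr scalerMnl mulr_natl.
  by rewrite sum_subfield_scale.
have EK : lsum Q lE \in K.
  suff -> : lsum Q lE =
      \sum_(t <- E | t != 0) lsum (fun x => Q (t * x)) l.
    by apply: (big_ind (fun v => v \in K)) => // t t0; apply: scaleK.
  have -> : lsum Q lE = A *: Q 0 + b *: N.
    by rewrite -(lEQ 0 E0); apply: eq_bigr => p _; rewrite addr0.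
  apply: (addrI (lsum (fun x => Q (0 * x)) l)).
  have <- : \sum_(t <- E) lsum (fun x => Q (t * x)) l =
      lsum (fun x => Q (0 * x)) l + \sum_(t <- E | t != 0) lsum (fun x => Q (t * x)) l.
    by rewrite (bigD1_seq 0).
  rewrite exchange_big /= (bigID (fun p => p.1 == 0)) /=.
  have -> : lsum (fun x => Q (0 * x)) l = (\sum_(p <- l) p.2) *: Q 0.
    by rewrite scaler_suml; apply: eq_bigr => p _; rewrite mul0r.
  rewrite addrA -scalerDl.
  have -> : \sum_(p <- l) p.2 + A = (size E)%:R * lcoef l 0 by rewrite /A; ring.
  congr (_ + _).
    rewrite /lcoef mulr_sumr scaler_suml big_seq_cond [RHS]big_seq_cond; apply: eq_bigr => p /andP[pl p0].
    by rewrite sumE ?p0 // sE // inE map_f ?orbT.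
  rewrite scaler_suml big_seq_cond [RHS]big_seq_cond; apply: eq_bigr => p /andP[pl /negbTE p0].
  by rewrite sumE ?p0 // sE // inE map_f ?orbT.
have A0 : A != 0 by rewrite subr_eq0.
rewrite -[Q z - _](scalerK A0) KZ // scalerBr.
have := KB (shiftK z EK) EK; rewrite lEQ //.
have -> : lsum Q lE = A *: Q 0 + b *: N.
  by rewrite -(lEQ 0 E0); apply: eq_bigr => p _; rewrite addr0.
by rewrite opprD addrACA subrr addr0.
Qed.

End AugmentationIdeal.

(** * The Bruhat decomposition of [SL2] *)

Section Bruhat.
Variable F : fieldType.
Local Notation G := (SL2 F).
Implicit Types d e x y : F.

Lemma sl2P (g h : G) : g 0 0 = h 0 0 -> g 0 1 = h 0 1 -> g 1 0 = h 1 0 ->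
  g 1 1 = h 1 1 -> g = h.
Proof.
have ord2 (i : 'I_2) : i = 0 \/ i = 1.
  by case: i => [[|[|//]] ?]; [left | right]; apply: val_inj.
move=> e00 e01 e10 e11; apply/val_inj/matrixP => i j.
by case: (ord2 i) (ord2 j) => -> [->|->].
Qed.

Definition mx22 (a b c d : F) : 'M[F]_2 :=
  \matrix_(i, j) (if i == 0 then if j == 0 then a else b
                  else if j == 0 then c else d).

Fact up_det x : \det (mx22 1 x 0 1) == 1.
Proof. by rewrite det22 !mxE /= mulr1 mulr0 subr0. Qed.
Definition up x : G := MkSL2 (up_det x).

(** The junk value at [0] makes [tor] total. *)
Fact tor_det d : \det (if d == 0 then 1%:M else mx22 d 0 0 d^-1) == 1.
Proof.
case: (eqVneq d 0) => [_|d0]; first by rewrite det1.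
by rewrite det22 !mxE /= mulr0 subr0 mulfV.
Qed.
Definition tor d : G := MkSL2 (tor_det d).

Lemma upE x : [/\ up x 0 0 = 1, up x 0 1 = x, up x 1 0 = 0 & up x 1 1 = 1].
Proof. by rewrite !mxE. Qed.

Lemma torE d : d != 0 ->
  [/\ tor d 0 0 = d, tor d 0 1 = 0, tor d 1 0 = 0 & tor d 1 1 = d^-1].
Proof. by rewrite /tor /= => /negbTE ->; rewrite !mxE. Qed.

Lemma weylE : [/\ weyl F 0 0 = 0, weyl F 0 1 = 1, weyl F 1 0 = -1 & weyl F 1 1 = 0].
Proof. by rewrite !mxE. Qed.

Local Ltac entries H :=
  let a := fresh in let b := fresh in let c := fresh in let d := fresh in
  have [a b c d] := H; rewrite ?a ?b ?c ?d; clear a b c d.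

Lemma upD x y : (up x * up y)%g = up (x + y).
Proof.
apply: sl2P; rewrite !sl2_mulE; entries (upE x);
  entries (upE y); entries (upE (x + y)); ring.
Qed.

Lemma up0 : up 0 = 1%g.
Proof. by apply: sl2P; rewrite sl2_oneE mxE. Qed.

Lemma tor1 : tor 1 = 1%g.
Proof. by apply: sl2P; entries (torE (oner_neq0 F)); rewrite sl2_oneE ?invr1. Qed.

Lemma torM d e : d != 0 -> e != 0 -> (tor d * tor e)%g = tor (d * e).
Proof.
move=> d0 e0; have de0 := mulf_neq0 d0 e0.
apply: sl2P; rewrite !sl2_mulE; entries (torE d0);
  entries (torE e0); entries (torE de0);
  rewrite ?invfM; ring.
Qed.

Lemma tor_up d x : d != 0 -> (tor d * up x)%g = (up (d ^+ 2 * x)%R * tor d)%g.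
Proof.
move=> d0; apply: sl2P; rewrite !sl2_mulE; entries (torE d0);
  entries (upE x); entries (upE (d ^+ 2 * x)); by field.
Qed.

Lemma weyl_tor d : d != 0 -> (weyl F * tor d)%g = (tor d^-1%R * weyl F)%g.
Proof.
move=> d0; have di0 : d^-1 != 0 by rewrite invr_eq0.
apply: sl2P; rewrite !sl2_mulE; entries (torE d0);
  entries (torE di0); entries weylE; rewrite ?invrK; ring.
Qed.

Lemma weyl_weyl : (weyl F * weyl F)%g = tor (-1).
Proof.
have m0 : -1 != 0 :> F by rewrite oppr_eq0 oner_neq0.
apply: sl2P; rewrite !sl2_mulE; entries (torE m0);
  entries weylE; rewrite ?invrN ?invr1; ring.
Qed.

Lemma weyl_up_weyl x : x != 0 ->
  (weyl F * up x * weyl F)%g = (up (- x^-1)%R * weyl F * tor (- x)%R * up (- x^-1)%R)%g.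
Proof.
move=> x0; have m0 : - x != 0 by rewrite oppr_eq0.
apply: sl2P; rewrite !sl2_mulE; entries (torE m0);
  entries weylE; entries (upE x);
  entries (upE (- x^-1)); field; rewrite ?x0 ?m0 //.
Qed.

Lemma borel_dec (g : G) : g 1 0 = 0 ->
  exists d x, [/\ d != 0, g = (up x * tor d)%g & d = g 0 0].
Proof.
move=> g10; have := sl2_detE g; rewrite g10 mulr0 subr0 => gd.
have g0 : g 0 0 != 0.
  by apply/eqP => E; move: gd; rewrite E mul0r => /eqP; rewrite eq_sym oner_eq0.
exists (g 0 0), (g 0 1 * g 0 0); split=> //.
apply: sl2P; rewrite !sl2_mulE; entries (torE g0);
  entries (upE (g 0 1 * g 0 0)); rewrite ?g10 ?mulr0 ?mul1r ?addr0 ?add0r ?mul0r //.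
- by rewrite -mulrA mulfV // mulr1.
- by rewrite -[LHS]mul1r -[in LHS](mulVf g0) -mulrA gd mulr1.
Qed.

Lemma bruhat (g : G) : g 1 0 != 0 ->
  exists d x y, d != 0 /\ g = (up x * weyl F * tor d * up y)%g.
Proof.
move=> g10; have gd := sl2_detE g.
have m0 : - g 1 0 != 0 by rewrite oppr_eq0.
exists (- g 1 0), (g 0 0 / g 1 0), (g 1 1 / g 1 0); split=> //.
have E : g 0 1 = (g 0 0 * g 1 1 - 1) / g 1 0 by rewrite -gd; field.
apply: sl2P; rewrite !sl2_mulE; entries (torE m0);
  entries weylE; entries (upE (g 0 0 / g 1 0));
  entries (upE (g 1 1 / g 1 0)); rewrite ?E; field; rewrite ?g10 ?m0 //.
Qed.

Lemma tor_is_torus d : tor d \in @is_torus F.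
Proof.
rewrite is_torusE; have [->|d0] := eqVneq d 0.
  by rewrite /tor /= eqxx !mxE !eqxx.
by entries (torE d0); rewrite eqxx.
Qed.
Definition torT d : torus F := exist _ (tor d) (tor_is_torus d).

Lemma torTM d e : d != 0 -> e != 0 -> (torT d * torT e)%g = torT (d * e).
Proof. by move=> d0 e0; apply: val_inj; apply: torM. Qed.

Lemma torT1 : torT 1 = 1%g.
Proof. by apply: val_inj; apply: tor1. Qed.

Lemma torusE (t : torus F) : exists2 d, d != 0 & t = torT d.
Proof.
have /andP[/eqP t01 /eqP t10] := valP t.
have [d [x [d0 Dt Dd]]] := borel_dec t10; exists d => //.
apply: val_inj; rewrite Dt /=; suff -> : x = 0 by rewrite up0 mul1g.
move: t01; rewrite Dt sl2_mulE; case: (torE d0) => _ -> _ ->.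
by case: (upE x) => -> -> _ _; rewrite mulr0 add0r => /eqP;
  rewrite mulf_eq0 invr_eq0 (negbTE d0) orbF => /eqP.
Qed.

Lemma up_is_unip x : up x \in @is_unip F.
Proof. by rewrite is_unipE; case: (upE x) => -> _ -> ->; rewrite !eqxx. Qed.
Definition upU x : unip F := exist _ (up x) (up_is_unip x).

Lemma unipE (u : unip F) : exists x, u = upU x.
Proof.
have /and3P[/eqP u00 /eqP u11 /eqP u10] := valP u.
exists (val u 0 1); apply/val_inj/sl2P => /=;
  by case: (upE (val u 0 1)) => e1 e2 e3 e4; rewrite ?u00 ?u11 ?u10 ?e1 ?e2 ?e3 ?e4.
Qed.

Lemma up_is_borel x : up x \in @is_borel F.
Proof. by rewrite is_borelE; case: (upE x) => _ _ -> _. Qed.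
Definition upB x : borel F := exist _ (up x) (up_is_borel x).

Lemma tor_is_borel d : tor d \in @is_borel F.
Proof. by have /andP[] := tor_is_torus d. Qed.
Definition torB d : borel F := exist _ (tor d) (tor_is_borel d).

Lemma borelE (b : borel F) : exists d x, [/\ d != 0, b = (upB x * torB d)%g,
  borel_torus b = torT d & d = val b 0 0].
Proof.
have /eqP b10 := valP b; have [d [x [d0 Db Dd]]] := borel_dec b10.
exists d, x; split=> //; first exact: val_inj.
apply/val_inj/sl2P; rewrite [LHS]mxE /= -?Dd; have [e1 e2 e3 e4] := torE d0;
  rewrite ?e1 ?e2 ?e3 ?e4 //.
have := sl2_detE (val b); rewrite b10 mulr0 subr0 -Dd => /(canRL (mulKf d0)).
by rewrite mulr1.
Qed.

End Bruhat.

(** * The action of [SL2] through its generators *)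

Section Action.
Variables (k F : fieldType) (M : gmod k (SL2 F)).

Definition U (x : F) : {linear M -> M} := gact (up x).
Definition T (d : F) : {linear M -> M} := gact (tor d).
Definition S : {linear M -> M} := gact (weyl F).

Implicit Types v : M.

Lemma UE x v : U x v = gact (up x) v. Proof. by []. Qed.

Lemma UD x y v : U x (U y v) = U (x + y) v.
Proof. by rewrite /U -gactM upD. Qed.

Lemma U0 v : U 0 v = v.
Proof. by rewrite /U up0 gact1. Qed.

Lemma UK x : cancel (U x) (U (- x)).
Proof. by move=> v; rewrite UD addNr U0. Qed.

Lemma UNK x : cancel (U (- x)) (U x).
Proof. by move=> v; rewrite UD addrN U0. Qed.

Lemma T1 v : T 1 v = v.
Proof. by rewrite /T tor1 gact1. Qed.

Lemma TM d e v : d != 0 -> e != 0 -> T d (T e v) = T (d * e) v.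
Proof. by move=> d0 e0; rewrite /T -gactM torM. Qed.

Lemma TU d x v : d != 0 -> T d (U x v) = U (d ^+ 2 * x) (T d v).
Proof. by move=> d0; rewrite /T /U -!gactM tor_up. Qed.

Lemma ST d v : d != 0 -> S (T d v) = T d^-1 (S v).
Proof. by move=> d0; rewrite /T /S -!gactM weyl_tor. Qed.

Lemma SS v : S (S v) = T (-1) v.
Proof. by rewrite /S /T -gactM weyl_weyl. Qed.

Lemma SUS x v : x != 0 -> S (U x (S v)) = U (- x^-1) (S (T (- x) (U (- x^-1) v))).
Proof. by move=> x0; rewrite /S /T /U -!gactM weyl_up_weyl. Qed.

(** [S] carries the point [x] of the big cell to [-1/x]; in homogeneous form,
  conjugation by the torus reduces to [x = 1]. *)
Lemma SU_scale t v : t != 0 -> S (U (t ^+ 2) v) = T t^-1 (S (U 1 (T t^-1 v))).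
Proof.
by move=> t0; rewrite -ST // TU // mulr1 TM ?invr_eq0 // mulfV // T1.
Qed.

(** By the Bruhat decomposition the three families of operators generate the action. *)
Lemma gen_hom (N : gmod k (SL2 F)) (f : M -> N) :
    (forall x v, f (gact (up x) v) = gact (up x) (f v)) ->
    (forall d v, d != 0 -> f (gact (tor d) v) = gact (tor d) (f v)) ->
    (forall v, f (gact (weyl F) v) = gact (weyl F) (f v)) ->
  forall g v, f (gact g v) = gact g (f v).
Proof.
move=> fU fT fS g v; have [/eqP g10|g10] := boolP (g 1 0 == 0).
  by have [d [x [d0 -> _]]] := borel_dec g10; rewrite !gactM fU fT.
have [d [x [y [d0 ->]]]] := bruhat g10.
by rewrite !gactM fU fS fT // fU.
Qed.

Definition ufix v := forall x, U x v = v.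

(** Characters of the torus as functions of the upper left entry. *)
Definition ev (lam : {multiplicative torus F -> units k}) (d : F) : k :=
  val (lam (torT d)).

Lemma ev_neq0 lam d : ev lam d != 0.
Proof. exact: (valP (lam (torT d))). Qed.

Lemma evM lam d e : d != 0 -> e != 0 -> ev lam (d * e) = ev lam d * ev lam e.
Proof. by move=> d0 e0; rewrite /ev -torTM // gmulfM. Qed.

Lemma ev1 lam : ev lam 1 = 1.
Proof. by rewrite /ev torT1 mult1. Qed.

Lemma evV lam d : d != 0 -> ev lam d^-1 = (ev lam d)^-1.
Proof.
move=> d0; apply: (mulfI (ev_neq0 lam d)).
by rewrite -evM ?invr_eq0 // mulfV // ev1 mulfV ?ev_neq0.
Qed.

Lemma wtP lam v : weight_space lam v <-> forall d, d != 0 -> T d v = ev lam d *: v.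
Proof.
split=> [H d _|H t]; first exact: (H (torT d)).
by have [d d0 ->] := torusE t; exact: (H d d0).
Qed.

End Action.

Arguments U {k F M} x.
Arguments T {k F M} d.
Arguments S {k F M}.
Arguments ufix {k F M} v.

(** * Cyclic modules of the unipotent group *)

Section Lists.
Variables (k F : fieldType).
Implicit Types l : seq (F * k).

Lemma lcoef_cat (V : nmodType) (l l' : seq (F * V)) y :
  lcoef (l ++ l') y = lcoef l y + lcoef l' y.
Proof. by rewrite /lcoef big_cat. Qed.

Lemma lcoef_scale (V : lmodType k) (a : k) (l : seq (F * V)) y :
  lcoef [seq (p.1, a *: p.2) | p <- l] y = a *: lcoef l y.
Proof. by rewrite /lcoef big_map scaler_sumr. Qed.

Lemma lcoef_notin (V : nmodType) (l : seq (F * V)) y :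
  y \notin unzip1 l -> lcoef l y = 0.
Proof.
move=> yl; rewrite /lcoef big_seq_cond big_pred0 // => p; apply/andP => -[pl /eqP py].
by case/negP: yl; rewrite -py map_f.
Qed.

Lemma lsum_cat (W : lmodType k) (Q : F -> W) l l' :
  lsum Q (l ++ l') = lsum Q l + lsum Q l'.
Proof. by rewrite /lsum big_cat. Qed.

Lemma lsum_scale (W : lmodType k) (Q : F -> W) a l :
  lsum Q [seq (p.1, a * p.2) | p <- l] = a *: lsum Q l.
Proof.
by rewrite /lsum big_map scaler_sumr; apply: eq_bigr => p _; rewrite scalerA.
Qed.

Lemma sum_lcoef (V W : nmodType) (f : F -> V -> W) (l : seq (F * V)) :
    (forall y, f y 0 = 0) -> (forall y, {morph f y : a b / a + b}) ->
  \sum_(p <- l) f p.1 p.2 = \sum_(y <- undup (unzip1 l)) f y (lcoef l y).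
Proof.
move=> f0 fD.
under [RHS]eq_bigr => y _ do
  rewrite /lcoef (big_morph (f y) (fD y) (f0 y)) big_mkcond /=.
rewrite exchange_big /= big_seq [RHS]big_seq; apply: eq_bigr => p pl.
have pX : p.1 \in undup (unzip1 l) by rewrite mem_undup map_f.
rewrite (bigD1_seq p.1) ?undup_uniq //= eqxx big1 ?addr0 // => y.
by rewrite eq_sym => /negbTE ->.
Qed.

Lemma lsum_lcoef (W : lmodType k) (Q : F -> W) l :
  lsum Q l = \sum_(y <- undup (unzip1 l)) lcoef l y *: Q y.
Proof.
apply: (sum_lcoef (f := fun y a => a *: Q y)) => y; first exact: scale0r.
by move=> a b; exact: scalerDl.
Qed.

End Lists.

Section Cyclic.
Variables (k : fieldType) (char0 : [pchar k] =i pred0).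
Variables (F : closedFieldType) (finF : locally_finite F).
Variable M : gmod k (SL2 F).
Implicit Types (v w xi : M) (lam : {multiplicative torus F -> units k}).

Lemma orbit_augmentation (K : {pred M}) xi lam l y z :
    submod_closed K -> (forall x v, v \in K -> U x v \in K) ->
    (forall d v, d != 0 -> v \in K -> T d v \in K) ->
    weight_space lam xi -> lcoef l y != 0 -> lsum (fun x => U x xi) l \in K ->
  U z xi - xi \in K.
Proof.
move=> subK KU KT /wtP xiw ly lK; rewrite -[X in _ - X]U0.
apply: (@augmentation_ideal k char0 F finF M (fun x => U x xi) K subK _ _ l y z ly lK)
  => {z ly lK y} [{}l y|{}l t t0] lK.
  suff -> : lsum (fun x => U (x + y) xi) l = U y (lsum (fun x => U x xi) l) by exact: KU.
  rewrite /lsum linear_sum; apply: eq_bigr => p _.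
  by rewrite linearZ /= UD addrC.
have [s s0 Ds] := exists_sqrt_neq0 t0.
suff -> : lsum (fun x => U (t * x) xi) l =
    (ev lam s)^-1 *: T s (lsum (fun x => U x xi) l).
  rewrite -[_ *: _]addr0; case: subK => K0; apply=> //.
  exact: KT.
rewrite /lsum linear_sum scaler_sumr; apply: eq_bigr => p _.
rewrite linearZ /= TU // xiw // Ds [U _ (_ *: _)]linearZ /= !scalerA.
by congr (_ *: _); field; rewrite ev_neq0.
Qed.

(** A difference [U z v - v] is not affected by a fixed summand of [v], and for
  generic [z] its coefficients contain those of [v] unchanged. *)
Lemma orbit_augmentation_mod (K : {pred M}) xi lam v0 l y z :
    submod_closed K -> (forall x v, v \in K -> U x v \in K) ->
    (forall d v, d != 0 -> v \in K -> T d v \in K) ->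
    weight_space lam xi -> ufix v0 -> lcoef l y != 0 ->
    v0 + lsum (fun x => U x xi) l \in K ->
  U z xi - xi \in K.
Proof.
move=> subK KU KT xiw fv0 ly vK.
have [w wl] := notin_seq [seq x - y | x <- unzip1 l].
pose l' := [seq (p.1 + w, p.2) | p <- l] ++ [seq (p.1, -1 * p.2) | p <- l].
apply: (@orbit_augmentation K xi lam l' (y + w)) => //.
  rewrite lcoef_cat (@lcoef_scale k F k^o) (lcoef_notin (l := l)); last first.
    by apply: contra wl => wl; apply/mapP; exists (y + w); rewrite // addrC addKr.
  rewrite scaler0 addr0 /lcoef big_map /=.
  by under eq_bigl do rewrite (inj_eq (addIr w)).
have -> : lsum (fun x => U x xi) l' = U w (v0 + lsum (fun x => U x xi) l)
    + (-1) *: (v0 + lsum (fun x => U x xi) l).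
  rewrite lsum_cat lsum_scale linearD /= fv0 scalerDr addrACA scaleN1r subrr add0r.
  congr (_ + _); rewrite linear_sum /lsum big_map; apply: eq_bigr => p _ /=.
  by rewrite linearZ /= UD addrC.
case: subK => K0 KP; rewrite addrC; apply: KP => //; exact: KU.
Qed.

Definition ufree xi := forall l, lsum (fun x => U x xi) l = 0 -> forall y, lcoef l y = 0.

Lemma zero_closed : submod_closed [pred v : M | v == 0].
Proof. by split=> [|a u v]; rewrite !inE ?eqxx // => /eqP -> /eqP ->; rewrite scaler0 addr0. Qed.

(** A torus eigenvector either generates a free module of rank one over the
  group algebra of the unipotent group or is fixed by it. *)
Lemma ufree_or_ufix xi lam : weight_space lam xi -> ~ ufree xi -> ufix xi.
Proof.
move=> xiw /existsNP[l /not_implyP[l0 /existsNP[y /eqP ly]]] z.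
apply/eqP; rewrite -subr_eq0.
apply: (@orbit_augmentation [pred v | v == 0] xi lam l y z) => //.
- exact: zero_closed.
- by move=> x v; rewrite !inE => /eqP ->; rewrite linear0.
- by move=> d v _; rewrite !inE => /eqP ->; rewrite linear0.
- by rewrite inE l0.
Qed.

Lemma ufree_inj xi l l' y : ufree xi ->
  lsum (fun x => U x xi) l = lsum (fun x => U x xi) l' -> lcoef l y = lcoef l' y.
Proof.
move=> fxi E; have /fxi/(_ y) : lsum (fun x => U x xi)
    (l ++ [seq (p.1, -1 * p.2) | p <- l']) = 0.
  by rewrite lsum_cat lsum_scale E scaleN1r subrr.
by rewrite lcoef_cat (@lcoef_scale k F k^o) scaleN1r => /subr0_eq.
Qed.

(** A fixed vector has coefficients invariant under translation, and finitely many. *)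
Lemma ufree_ufix xi v l : ufree xi -> v = lsum (fun x => U x xi) l -> ufix v ->
  forall y, lcoef l y = 0.
Proof.
move=> fxi Dv fv y; have [z zl] := notin_seq [seq y - x | x <- unzip1 l].
rewrite -(@lcoef_notin _ _ l (y - z)); last first.
  by apply: contra zl => zl; apply/mapP; exists (y - z); rewrite // opprB addrC subrK.
have -> : lcoef l (y - z) = lcoef [seq (p.1 + z, p.2) | p <- l] y.
  by rewrite /lcoef big_map; apply: eq_bigl => p /=; rewrite eq_sym subr_eq eq_sym.
apply: (ufree_inj _ fxi); rewrite -Dv -{1}(fv z) Dv /lsum big_map linear_sum.
by apply: eq_bigr => p _; rewrite linearZ /= UD addrC.
Qed.

Lemma unip_spanP xi v :
  unip_span xi v <-> exists l, v = lsum (fun x => U x xi) l.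
Proof.
split=> [[n [c [e [eA ->]]]]|[l ->]].
  have /choice[f fE] : forall i, exists x, e i = U x xi.
    by move=> i; have [u _ <-] := eA i; have [x ->] := unipE u; exists x.
  exists [seq (f i, c i) | i <- enum 'I_n].
  by rewrite /lsum big_map big_enum; apply: eq_bigr => i _; rewrite fE.
exists (size l), (fun i => (tnth (in_tuple l) i).2), (fun i => U (tnth (in_tuple l) i).1 xi).
split=> [i|]; first by exists (upU (tnth (in_tuple l) i).1).
by rewrite /lsum big_tnth.
Qed.

End Cyclic.

Section Cells.
Variables (k F : fieldType).

Definition emb (M : lmodType k) r (eta : 'I_r -> M) (v : 'cV[k]_r) : M :=
  \sum_j v j 0 *: eta j.

(** A finite free basis [eta], made of torus eigenvectors, of the module modulo
  the vectors fixed by the unipotent group; [co] reads the coefficients at the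
  origin of the cell, hence [co (U (- x) v)] the coefficients at [x]. *)
Record cells (M : gmod k (SL2 F)) := Cells {
  rk : nat;
  eta : 'I_rk -> M;
  wts : 'I_rk -> {multiplicative torus F -> units k};
  co : {linear M -> 'cV[k]_rk};
  eta_wt : forall j, weight_space (wts j) (eta j);
  co_eta : forall j x, co (U x (eta j)) = if x == 0 then delta_mx j 0 else 0;
  co_ufix : forall v, ufix v -> co v = 0;
  cells_dec : forall v, exists (l : seq (F * 'cV[k]_rk)) (v0 : M),
    ufix v0 /\ v = v0 + \sum_(p <- l) U p.1 (emb eta p.2);
  ufix_eigen : forall v, ufix v -> exists m (e : 'I_m -> M),
    (forall i, ufix (e i) /\ eigenvector (e i)) /\ v = \sum_i e i }.

End Cells.

Arguments eta {k F M} c j.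
Arguments wts {k F M} c j.
Arguments co {k F M} c.
Arguments eta_wt {k F M} c j.
Arguments co_eta {k F M} c j x.
Arguments co_ufix {k F M} c [v] _.
Arguments cells_dec {k F M} c v.
Arguments ufix_eigen {k F M} c [v] _.

Section CellsOfC.
Variables (k : fieldType) (char0 : [pchar k] =i pred0).
Variables (F : closedFieldType) (finF : locally_finite F).
Variable M : gmod k (SL2 F).

(** The free summands provide the cell, the other ones the fixed vectors. *)
Lemma in_C_cells : in_C M -> exists _ : cells M, True.
Proof.
move=> [n [_ [xi [xi_eig [phi [phiB phi_inj phi_im]]]]]].
have /choice[lam xiw] : forall i, exists lam, weight_space lam (xi i) by [].
pose dl i v : {ffun 'I_n -> M} := [ffun j => if j == i then v else 0].
have /choice[ze zeE] : forall i, exists z, phi z = dl i (xi i).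
  move=> i; apply/phi_im => j; apply/unip_spanP; rewrite ffunE.
  case: eqP => [->|_]; last by exists [::]; rewrite /lsum big_nil.
  by exists [:: (0, 1)]; rewrite /lsum big_seq1 scale1r U0.
have phiU x v : phi (U x v) = [ffun j => U x ((phi v : {ffun _ -> _}) j)].
  exact: (phiB (upB x)).
have phiT d v : phi (T d v) = [ffun j => T d ((phi v : {ffun _ -> _}) j)].
  exact: (phiB (torB d)).
have zew i : weight_space (lam i) (ze i).
  apply/wtP => d d0; apply: phi_inj; rewrite phiT linearZ /= zeE.
  apply/ffunP => j; rewrite !ffunE; case: eqP => _; last by rewrite linear0 scaler0.
  by have /wtP -> := xiw i.
have zeU i x : phi (U x (ze i)) = dl i (U x (xi i)).
  rewrite phiU zeE; apply/ffunP => j; rewrite !ffunE.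
  by case: eqP => // _; rewrite linear0.
have /choice[L LE] : forall v, exists l : 'I_n -> seq (F * k),
    forall i, (phi v : {ffun _ -> _}) i = lsum (fun x => U x (xi i)) (l i).
  move=> v; have H := (phi_im (phi v)).1 (ex_intro _ v erefl).
  have /choice[l Hl] : forall i, exists l,
      (phi v : {ffun _ -> _}) i = lsum (fun x => U x (xi i)) l.
    by move=> i; apply/unip_spanP; exact: H.
  by exists l.
have decE v : v = \sum_i lsum (fun x => U x (ze i)) (L v i).
  apply: phi_inj; rewrite linear_sum; apply/ffunP => j.
  rewrite sum_ffunE (bigD1 j) //= big1 => [|i ij].
    rewrite addr0 LE linear_sum sum_ffunE; apply: eq_bigr => p _.
    by rewrite linearZ /= zeU !ffunE eqxx.
  rewrite linear_sum sum_ffunE; apply: big1 => p _.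
  by rewrite linearZ /= zeU !ffunE eq_sym (negbTE ij) scaler0.
pose fr := [pred i | `[< ufree (xi i) >]].
have frP i : fr i -> ufree (xi i) by move/asboolP.
have zeF i : ~~ fr i -> ufix (ze i).
  move=> /asboolP nf x; apply: phi_inj; rewrite zeU zeE.
  by rewrite (ufree_or_ufix char0 finF (xiw i) nf).
pose r := #|fr|.
have frV (j : 'I_r) : ufree (xi (enum_val j)) by apply: frP; exact: (enum_valP j).
pose c v : 'cV[k]_r := \col_j lcoef (L v (enum_val j)) 0.
have cE v (j : 'I_r) l :
    (phi v : {ffun _ -> _}) (enum_val j) = lsum (fun x => U x (xi (enum_val j))) l ->
    c v j 0 = lcoef l 0.
  by move=> El; rewrite mxE; apply: (ufree_inj _ (frV j)); rewrite -LE.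
have clin : linear c.
  move=> a u v; apply/matrixP => j j'; rewrite (ord1 j').
  rewrite (cE _ j ([seq (p.1, a * p.2) | p <- L u (enum_val j)] ++ L v (enum_val j))).
    by rewrite lcoef_cat (@lcoef_scale k F k^o) !mxE.
  by rewrite lsum_cat lsum_scale -!LE linearP !ffunE.
pose co : {linear M -> 'cV[k]_r} :=
  HB.pack c (GRing.isLinear.Build k M 'cV[k]_r *:%R c clin).
have fix0 v : ufix v -> forall i, fr i -> forall y, lcoef (L v i) y = 0.
  move=> fv i /frP fi; apply: (ufree_ufix fi (LE v i)) => x.
  by rewrite -[in RHS](fv x) phiU ffunE.
pose et (j : 'I_r) := ze (enum_val j).
have lsum0 v i : ~~ fr i ->
    lsum (fun x => U x (ze i)) (L v i) = (\sum_(p <- L v i) p.2) *: ze i.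
  move=> nf; rewrite scaler_suml; apply: eq_bigr => p _.
  by rewrite (zeF i nf).
have co_eta j x : co (U x (et j)) = if x == 0 then delta_mx j 0 else 0.
  apply/matrixP => j' j0; rewrite (ord1 j0) /=.
  rewrite (cE _ j' (if j' == j then [:: (x, 1)] else [::])).
    rewrite /lcoef; have [->|nj] := eqVneq j' j; last first.
      by rewrite big_nil; case: eqP; rewrite !mxE // (negbTE nj).
    by rewrite big_cons big_nil /= addr0; case: eqP; rewrite !mxE ?eqxx.
  rewrite zeU ffunE (inj_eq enum_val_inj) /lsum.
  by have [->|nj] := eqVneq j' j; rewrite ?big_nil // big_seq1 scale1r.
have co_fix v : ufix v -> co v = 0.
  move=> fv; apply/matrixP => j j0; rewrite !mxE.
  by apply: (fix0 v fv); exact: (enum_valP j).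
suff H1 : (forall v, exists (l : seq (F * 'cV[k]_r)) (v0 : M),
    ufix v0 /\ v = v0 + \sum_(p <- l) U p.1 (emb et p.2)) /\
  (forall v, ufix v -> exists m (e : 'I_m -> M),
    (forall i, ufix (e i) /\ eigenvector (e i)) /\ v = \sum_i e i).
  case: H1 => H1 H2.
  by exists (@Cells k F M r et (fun j => lam (enum_val j)) co
    (fun j => zew (enum_val j)) co_eta co_fix H1 H2).
have sumfix v : ufix (\sum_(i | ~~ fr i) lsum (fun x => U x (ze i)) (L v i)).
  move=> x; rewrite linear_sum; apply: eq_bigr => i nf.
  by rewrite lsum0 // linearZ /= (zeF i nf).
split=> [v|v fv]; last first.
  exists n, (fun i => (if fr i then 0 else \sum_(p <- L v i) p.2) *: ze i); split=> [i|].
    split=> [x|].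
      by case: ifPn => [_|nf]; rewrite linearZ /= ?scale0r // (zeF i nf).
    exists (lam i); apply/wtP => d d0; rewrite linearZ /=.
    by have /wtP -> := zew i; rewrite // !scalerA mulrC.
  rewrite {1}[v]decE; apply: eq_bigr => i _; case: ifPn => [fi|nf]; last exact: lsum0.
  by rewrite scale0r lsum_lcoef big1 // => y _; rewrite (fix0 v) // scale0r.
exists [seq (p.1, p.2 *: delta_mx j 0) | j <- enum 'I_r, p <- L v (enum_val j)].
exists (\sum_(i | ~~ fr i) lsum (fun x => U x (ze i)) (L v i)); split=> //.
rewrite {1}[v]decE (bigID fr) /= addrC; congr (_ + _).
rewrite big_allpairs_dep /= big_enum /= big_enum_val; apply: eq_bigr => j _.
apply: eq_bigr => p _; rewrite -linearZ /=; congr (U _ _).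
rewrite /emb (bigD1 j) //= big1 ?addr0 => [|i ij].
  by rewrite !mxE eqxx mulr1.
by rewrite !mxE (negbTE ij) mulr0 scale0r.
Qed.

End CellsOfC.

(** * The Weyl element on the open cell *)

Lemma distinct_seq (F : closedFieldType) n : exists2 s : seq F, uniq s & size s = n.
Proof.
elim: n => [|n [s us ss]]; first by exists [::].
by have [x xs] := notin_seq s; exists (x :: s); rewrite /= ?xs ?ss.
Qed.

(** Any [m * n + 1] matrices of a family indexed by the infinite set [F] are
  linearly dependent. *)
Lemma linear_relation (k : fieldType) (F : closedFieldType) m n (Q : F -> 'M[k]_(m, n)) :
  exists (l : seq (F * k)) y, lcoef l y != 0 /\ lsum Q l = 0.
Proof.
have [s us ss] := distinct_seq F (m * n).+1.
pose A := \matrix_(i < (m * n).+1) mxvec (Q s`_i).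
have : kermx A != 0.
  rewrite kermx_eq0; apply/negP => /eqP rA.
  by have := rank_leq_col A; rewrite rA ltnn.
case/rowV0Pn => v /sub_kermxP vA /rV0Pn[i vi].
exists [seq (s`_(i : 'I_ _), v 0 i) | i <- enum 'I_(m * n).+1], s`_i; split.
  rewrite /lcoef big_map big_enum_cond /= (bigD1 i) //= big1 ?addr0 // => j /andP[sji ji].
  by case/negP: ji; rewrite -(inj_eq val_inj) /= -(nth_uniq 0 _ _ us) // ss.
rewrite /lsum big_map big_enum /=; apply: (can_inj mxvecK); rewrite linear0 -vA.
rewrite linear_sum mulmx_sum_row; apply: eq_bigr => j _.
by rewrite linearZ rowK.
Qed.

Section BigCell.
Variables (k : fieldType) (F : closedFieldType).
Variables (M : gmod k (SL2 F)) (D : cells M).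
Implicit Types (n e w : M) (lam : {multiplicative torus F -> units k}).

Local Notation r := (rk D).
Local Notation co := (co D).
Local Notation eta := (eta D).
Local Notation wts := (wts D).
Local Notation E v := (emb eta v).
Implicit Types v : 'cV[k]_r.

Fact emb_linear : linear (emb eta).
Proof.
move=> a u v; rewrite /emb scaler_sumr -big_split; apply: eq_bigr => j _ /=.
by rewrite !mxE scalerA scalerDl.
Qed.
HB.instance Definition _ := GRing.isLinear.Build k 'cV[k]_r M *:%R (emb eta) emb_linear.

(** The torus action on coefficients. *)
Definition Lam d : 'M[k]_r := diag_mx (\row_j ev (wts j) d).

Lemma LamM d (e : F) : d != 0 -> e != 0 -> Lam d *m Lam e = Lam (d * e).
Proof.
move=> d0 e0; rewrite /Lam mulmx_diag; congr diag_mx.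
by apply/rowP => j; rewrite !mxE evM.
Qed.

Lemma Lam1 : Lam 1 = 1%:M.
Proof.
rewrite /Lam -diag_const_mx; congr diag_mx; apply/rowP => j.
by rewrite !mxE ev1.
Qed.

Lemma LamV d : d != 0 -> Lam d *m Lam d^-1 = 1%:M.
Proof. by move=> d0; rewrite LamM ?invr_eq0 // mulfV // Lam1. Qed.

Lemma LamVK d : d != 0 -> Lam d^-1 *m Lam d = 1%:M.
Proof. by move=> d0; rewrite LamM ?invr_eq0 // mulVf // Lam1. Qed.

Lemma coUE x v : co (U x (E v)) = if x == 0 then v else 0.
Proof.
rewrite /emb !linear_sum [X in X = _](eq_bigr (fun j => v j 0 *: (if x == 0 then delta_mx j 0 else 0))).
  case: eqP => _; last by rewrite big1 // => j _; rewrite scaler0.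
  by rewrite [RHS]matrix_sum_delta; apply: eq_bigr => j _; rewrite big_ord1.
by move=> j _; rewrite !linearZ /= co_eta.
Qed.

Lemma coE v : co (E v) = v.
Proof. by rewrite -[E v]U0 coUE eqxx. Qed.

Lemma TE d v : d != 0 -> T d (E v) = E (Lam d *m v).
Proof.
move=> d0; rewrite /emb linear_sum; apply: eq_bigr => j _.
rewrite linearZ /=; have /wtP -> := eta_wt D j => //.
by rewrite scalerA mul_diag_mx !mxE mulrC.
Qed.

Lemma ufixT d n : d != 0 -> ufix n -> ufix (T d n).
Proof.
move=> d0 fn x; rewrite -[in RHS](fn (d ^- 2 * x)) TU // mulrA mulfV ?mul1r //.
by rewrite expf_neq0.
Qed.

Lemma coU_list n0 (l : seq (F * 'cV[k]_r)) y : ufix n0 ->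
  co (U (- y) (n0 + \sum_(p <- l) U p.1 (E p.2))) = lcoef l y.
Proof.
move=> fn0; rewrite !linearD /= fn0 co_ufix // add0r !linear_sum /lcoef [RHS]big_mkcond.
by apply: eq_bigr => p _; rewrite /= UD coUE addrC subr_eq0.
Qed.

Lemma co_dec n : exists (X : seq F) n0, [/\ uniq X, ufix n0,
  n = n0 + \sum_(y <- X) U y (E (co (U (- y) n))) &
  forall y, y \notin X -> co (U (- y) n) = 0].
Proof.
have [l [n0 [fn0 Dn]]] := cells_dec D n.
exists (undup (unzip1 l)), n0; split=> //; first exact: undup_uniq.
  rewrite {1}Dn; congr (_ + _).
  rewrite (sum_lcoef (f := fun y v => U y (E v))) => [|y|y a b]; rewrite ?linear0 ?linearD //.
  by apply: eq_bigr => y _; rewrite Dn coU_list.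
by move=> y yl; rewrite Dn coU_list // lcoef_notin // -mem_undup.
Qed.

Lemma co_finite n : exists X : seq F, forall x, x \notin X -> co (U (- x) n) = 0.
Proof. by have [X [_ [_ _ _ XP]]] := co_dec n; exists X. Qed.

Lemma ufix_co n : (forall x, co (U x n) = 0) -> ufix n.
Proof.
move=> n0; have [X [n1 [_ fn1 -> _]]] := co_dec n.
by rewrite big1 ?addr0 // => y _; rewrite n0 !linear0.
Qed.

Lemma coT d n : d != 0 -> co (T d n) = Lam d *m co n.
Proof.
move=> d0; have [l [n0 [fn0 Dn]]] := cells_dec D n.
have fT := ufixT d0 fn0.
pose lT := [seq (d ^+ 2 * p.1, Lam d *m p.2) | p <- l].
have DT : T d n = T d n0 + \sum_(p <- lT) U p.1 (E p.2).
  rewrite {1}Dn linearD linear_sum big_map; congr (_ + _).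
  by apply: eq_bigr => p _; rewrite /= TU // TE.
have := coU_list lT 0 fT; rewrite -DT oppr0 U0 => ->.
have := coU_list l 0 fn0; rewrite -Dn oppr0 U0 => ->.
rewrite /lcoef big_map linear_sum; apply: eq_bigl => p /=.
by rewrite mulf_eq0 expf_eq0 (negbTE d0) andbF.
Qed.

(** The coefficients of an eigenvector outside the origin are permuted, up to
  scalars, by the torus, which has infinite orbits there. *)
Lemma co_eig e x : eigenvector e -> x != 0 -> co (U x e) = 0.
Proof.
move=> [lam /wtP ew] x0; have [X XP] := co_finite e.
have [z] := notin_seq (0 :: [seq - y | y <- X]); rewrite inE negb_or => /andP[z0 zX].
have [d d0 Dd] : exists2 d, d != 0 & d ^+ 2 = z / x.
  by apply: exists_sqrt_neq0; rewrite mulf_neq0 ?invr_eq0.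
have : co (T d (U x e)) = 0.
  rewrite TU // Dd mulfVK // ew // !linearZ /= -[z]opprK XP ?scaler0 //.
  by apply: contra zX => zX; rewrite -[z]opprK map_f.
by rewrite coT // => /(congr1 (mulmx (Lam d^-1))); rewrite mulmx0 mulmxA LamVK // mul1mx.
Qed.

Lemma wt_S lam e : weight_space lam e ->
  exists lam', weight_space lam' (S e) /\ forall d, d != 0 -> ev lam' d = (ev lam d)^-1.
Proof.
move=> /wtP ew.
have invM : {morph (fun t : torus F => (lam t)^-1%g) : t u / (t * u)%g}.
  move=> t u; rewrite gmulfM invgM; apply: val_inj; exact: mulrC.
pose lam' : {multiplicative torus F -> units k} :=
  HB.pack (fun t : torus F => (lam t)^-1%g)
    (isMultiplicative.Build (torus F) (units k) (fun t => (lam t)^-1%g) invM).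
exists lam'; split=> //; apply/wtP => d d0.
have di0 : d^-1 != 0 by rewrite invr_eq0.
by rewrite -[d]invrK -ST // ew // linearZ /= invrK evV.
Qed.

Lemma eig_S e : eigenvector e -> eigenvector (S e).
Proof. by move=> [lam /wt_S[lam' [Sw _]]]; exists lam'. Qed.

(** A fixed vector is a sum of eigenvectors, and so is its image under [S]. *)
Lemma co_S_ufix n x : ufix n -> x != 0 -> co (U x (S n)) = 0.
Proof.
move=> fn x0; have [m [e [eP ->]]] := ufix_eigen D fn.
rewrite !linear_sum; apply: big1 => i _; apply: co_eig => //.
by apply: eig_S; case: (eP i).
Qed.

Lemma eig_dec e : eigenvector e -> ufix (e - E (co e)).
Proof.
move=> ee; apply: ufix_co => x; rewrite !linearB /= coUE.
by have [->|x0] := eqVneq x 0; rewrite ?U0 ?subrr // co_eig // subrr.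
Qed.

(** The coefficient at [y] of the image under the Weyl element of the fibre at
  the point [1]; by homogeneity it determines those of all other fibres. *)
Definition Cf y v := co (U (- y) (S (U 1 (E v)))).

Fact Cf_linear y : linear (Cf y).
Proof. by move=> a u v; rewrite /Cf !linearP. Qed.
HB.instance Definition _ y := GRing.isLinear.Build k 'cV[k]_r 'cV[k]_r *:%R (Cf y) (Cf_linear y).

Lemma Cf_scale t y v : t != 0 ->
  co (U (- y) (S (U (t ^+ 2) (E v)))) = Lam t^-1 *m Cf (t ^+ 2 * y) (Lam t^-1 *m v).
Proof.
move=> t0; have ti0 : t^-1 != 0 by rewrite invr_eq0.
rewrite SU_scale // TE //.
have -> : - y = t^-1 ^+ 2 * (- (t ^+ 2 * y)) by rewrite mulrN mulrA -exprMn mulVf // expr1n mul1r.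
by rewrite -TU // coT.
Qed.

Lemma Cf_support : exists X : seq F, forall y, y \notin X -> forall v, Cf y v = 0.
Proof.
have /choice[X XP] : forall j, exists X : seq F, forall y, y \notin X -> Cf y (delta_mx j 0) = 0.
  by move=> j; apply: co_finite.
exists (flatten [seq X j | j <- enum 'I_r]) => y yX v.
rewrite [v]matrix_sum_delta linear_sum big1 // => j _.
rewrite big_ord1 linearZ /= XP ?scaler0 //.
by apply: contra yX => yX; apply/flattenP; exists (X j); rewrite ?map_f ?mem_enum.
Qed.

(** The next two lemmas compute the coefficient at [Y] of [s u_x s u_1 v]: term by
  term, and after rewriting [s u_x s] in the big cell. *)
Lemma Cf_left x Y v : Y != 0 -> exists2 X : seq F,
   uniq X /\ (forall y, y \notin X -> Cf y v = 0) &
   co (U (- Y) (S (U x (S (U 1 (E v)))))) =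
     \sum_(y <- X) co (U (- Y) (S (U (x + y) (E (Cf y v))))).
Proof.
move=> Y0; have [X [n0 [uX fn0 Dn XP]]] := co_dec (S (U 1 (E v))).
exists X => //.
have lin (f : {linear M -> 'cV[k]_r}) (g : F -> M) m :
    f (m + \sum_(y <- X) g y) = f m + \sum_(y <- X) f (g y).
  by rewrite linearD linear_sum.
have := lin (co \o U (- Y) \o S \o U x : {linear _ -> _}) (fun y => U y (E (Cf y v))) n0.
rewrite /= -Dn fn0 (co_S_ufix fn0) ?oppr_eq0 // add0r => ->.
by apply: eq_bigr => y _; rewrite UD.
Qed.

Lemma Cf_right x t Y v : x != 0 -> t != 0 -> t ^+ 2 = x ^+ 2 - x ->
  co (U (- Y) (S (U x (S (U 1 (E v)))))) =
  Lam t^-1 *m Cf (t ^+ 2 * (Y + x^-1)) (Lam t^-1 *m (Lam (- x) *m v)).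
Proof.
move=> x0 t0 Dt; have mx0 : - x != 0 by rewrite oppr_eq0.
rewrite SUS // (UD (- x^-1) 1) TU // TE // UD.
have -> : (- x) ^+ 2 * (- x^-1 + 1) = t ^+ 2 by rewrite Dt; field.
have -> : - Y - x^-1 = - (Y + x^-1) by rewrite opprD.
by rewrite Cf_scale.
Qed.

(** Both sides of [s u_x s u_1 = u_(-1/x) s h u_(1-1/x)] are read at the point
  where the term indexed by [tau] of the right-hand side lies. For generic [x]
  no term of the left-hand side lies there unless [tau] is [0] or [-1]. *)
Lemma Cf_eq0 tau v : tau != 0 -> tau != -1 -> Cf tau v = 0.
Proof.
move=> tau0 tau1; have [X XP] := Cf_support.
(* [x] is a root of [f s t] when the term of the left-hand side coming from [s]
  and [t] lies at the same point as that of [tau]. *)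
pose f (s t : F) : {poly F} :=
  ((tau + 1)%:P - 'X) * (s%:P + 'X) - t%:P * ('X ^+ 2 - 'X).
have fE s t x : (f s t).[x] = (tau + 1 - x) * (s + x) - t * (x ^+ 2 - x).
  by rewrite /f !hornerE.
have f0 s t : f s t != 0.
  apply/eqP => fst.
  have E1 : (f s t).[1] = tau * (s + 1) by rewrite fE; ring.
  have E0 : (f s t).[0] = (tau + 1) * s by rewrite fE; ring.
  move: E1 E0; rewrite fst !horner0 => /esym/eqP; rewrite mulf_eq0 (negbTE tau0) /=.
  move=> s1 /esym/eqP; rewrite mulf_eq0 addr_eq0 (negbTE tau1) /= => /eqP s0.
  by rewrite s0 add0r oner_eq0 in s1.
have P0 : \prod_(s <- X) \prod_(t <- X) f s t != 0.
  by rewrite prodf_seq_neq0; apply/allP => s _; rewrite /= prodf_seq_neq0;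
    apply/allP => t _; rewrite /= f0.
have [x Px] := nonroot_seq ([:: 0; 1; tau + 1] ++ [seq - s | s <- X]) P0.
rewrite mem_cat !inE !negb_or -!andbA => /and4P[x0 x1 xt xX].
have xsX s : s \in X -> x + s != 0.
  by move=> sX; apply: contra xX; rewrite addr_eq0 => /eqP ->; rewrite map_f.
have xx0 : x ^+ 2 - x != 0.
  have -> : x ^+ 2 - x = x * (x - 1) by ring.
  by rewrite mulf_neq0 // subr_eq0.
pose Y := (tau - x + 1) / (x ^+ 2 - x).
have Y0 : Y != 0.
  rewrite mulf_neq0 ?invr_eq0 // addrAC subr_eq0 eq_sym //.
have [t t0 Dt] := exists_sqrt_neq0 xx0.
have mx0 : - x != 0 by rewrite oppr_eq0.
have key (w : 'cV[k]_r) : Lam t^-1 *m Cf tau (Lam t^-1 *m (Lam (- x) *m w)) = 0.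
  have -> : tau = t ^+ 2 * (Y + x^-1).
    by rewrite Dt /Y; field; rewrite x0 xx0.
  rewrite -Cf_right //; have [X' [_ XP'] ->] := Cf_left x w Y0.
  rewrite big1_seq // => y /andP[_ _].
  have [yX|yX] := boolP (y \in X); last by rewrite XP // !linear0.
  have [b b0 Db] := exists_sqrt_neq0 (xsX y yX).
  rewrite -Db Cf_scale // XP ?mulmx0 //; apply: contra Px => bX.
  rewrite rootE horner_prod prodf_seq_eq0; apply/hasP; exists y => //=.
  rewrite horner_prod prodf_seq_eq0; apply/hasP; exists (b ^+ 2 * Y) => //=.
  by apply/eqP; rewrite fE Db /Y; field.
have := congr1 (mulmx (Lam t)) (key (Lam (- x)^-1 *m (Lam t *m v))).
rewrite mulmx0 mulmxA LamV // mul1mx (mulmxA (Lam (- x))) LamV // mul1mx.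
by rewrite mulmxA LamVK // mul1mx.
Qed.

End BigCell.

(** * Additive one-parameter groups normalized by a torus *)

Section AdditiveConjugates.
Variables (k : fieldType) (char0 : [pchar k] =i pred0).
Variables (F : closedFieldType) (finF : locally_finite F).
Variables (r : nat) (L : F -> 'M[k]_r) (Q : 'M[k]_r).
Hypothesis L1 : L 1 = 1%:M.
Hypothesis LM : forall d e, d != 0 -> e != 0 -> L d *m L e = L (d * e).
Hypothesis Qunit : Q \in unitmx.
Hypothesis QL : Q *m L (-1) = L (-1) *m Q.
Hypothesis Qrel : forall a b, a != 0 -> b != 0 -> a ^+ 2 = b ^+ 2 + 1 ->
  Q *m (L b^-1 *m Q *m L b) = L a^-1 *m Q *m L a.

Let V0 (d : F) : d != 0 -> d^-1 != 0. Proof. by rewrite invr_eq0. Qed.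
Let LV d : d != 0 -> L d *m L d^-1 = 1%:M.
Proof. by move=> d0; rewrite LM ?V0 // mulfV. Qed.
Let LVK d : d != 0 -> L d^-1 *m L d = 1%:M.
Proof. by move=> d0; rewrite LM ?V0 // mulVf. Qed.

Let rt (y : F) : F := sval (cid (exists_sqrt y)).
Let rtE y : rt y ^+ 2 = y. Proof. exact: svalP (cid (exists_sqrt y)). Qed.

Let A y := if y == 0 then 1%:M else L (rt y)^-1 *m Q *m L (rt y).

Let AE d : d != 0 -> A (d ^+ 2) = L d^-1 *m Q *m L d.
Proof.
move=> d0; rewrite /A expf_eq0 (negbTE d0) /=.
have := rtE (d ^+ 2) => /eqP; rewrite eqf_sqr => /orP[/eqP -> //|/eqP ->].
have m0 : -1 != 0 :> F by rewrite oppr_eq0 oner_neq0.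
have -> : (- d)^-1 = d^-1 * -1 by rewrite invrN mulrN1.
rewrite -[- d]mulN1r -!LM ?V0 // !mulmxA -(mulmxA (L d^-1)) -QL.
by rewrite mulmxA -(mulmxA _ (L (-1)) (L (-1))) LM // mulrNN mulr1 L1 mulmx1.
Qed.

Let A_scale d y : d != 0 -> A (d ^+ 2 * y) = L d^-1 *m A y *m L d.
Proof.
move=> d0; have [->|/exists_sqrt_neq0[e e0 <-]] := eqVneq y 0.
  by rewrite mulr0 /A eqxx mulmx1 LVK.
have de0 : d * e != 0 by rewrite mulf_neq0.
by rewrite -exprMn !AE // invfM -(LM (V0 d0) (V0 e0)) [d * e]mulrC -LM // !mulmxA.
Qed.

Let A1 : A 1 = Q.
Proof. by have := AE (oner_neq0 F); rewrite expr1n invr1 L1 mul1mx mulmx1. Qed.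

Let AD1 z : z != 0 -> 1 + z != 0 -> A 1 *m A z = A (1 + z).
Proof.
move=> /exists_sqrt_neq0[b b0 <-] /exists_sqrt_neq0[a a0 Da].
rewrite -Da A1 !AE //.
by apply: Qrel; rewrite // Da addrC.
Qed.

Let AD' y z : y != 0 -> z != 0 -> y + z != 0 -> A y *m A z = A (y + z).
Proof.
move=> y0 z0 yz0; have [d d0 Dy] := exists_sqrt_neq0 y0.
have {1}-> : y = d ^+ 2 * 1 by rewrite mulr1.
have Dz : z = d ^+ 2 * (z / y) by rewrite Dy mulrC divfK.
have -> : y + z = d ^+ 2 * (1 + z / y) by rewrite mulrDr mulr1 -Dz Dy.
rewrite {1}Dz !A_scale // -AD1 ?mulf_neq0 ?V0 //; last first.
  by rewrite -[1](divff y0) -mulrDl mulf_neq0 ?V0.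
by rewrite !mulmxA -(mulmxA _ (L d) (L d^-1)) LV // mulmx1.
Qed.

Let A_unit y : A y \in unitmx.
Proof.
have [->|/exists_sqrt_neq0[d d0 <-]] := eqVneq y 0; first by rewrite /A eqxx unitmx1.
have [L1u L2u] := mulmx1_unit (LV d0).
by rewrite AE // !unitmx_mul L1u L2u Qunit.
Qed.

Let AD y z : A y *m A z = A (y + z).
Proof.
have A0 : A 0 = 1%:M by rewrite /A eqxx.
have [->|y0] := eqVneq y 0; first by rewrite A0 mul1mx add0r.
have [->|z0] := eqVneq z 0; first by rewrite A0 mulmx1 addr0.
have [yz0|yz0] := eqVneq (y + z) 0; last exact: AD'.
have [w] := notin_seq [:: 0; y]; rewrite !inE negb_or => /andP[w0 wy].
have Dy : y = - z by apply/eqP; rewrite -addr_eq0 yz0.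
have zw0 : z + w != 0 by rewrite addrC addr_eq0 -Dy.
rewrite yz0 A0 -[LHS](mulmxK (A_unit w)) -(mulmxA (A y)) (AD' z0) //.
by rewrite (AD' y0) ?addrA ?yz0 ?add0r // mulmxV.
Qed.

(** The conjugates of [Q] under the torus form an additive one-parameter group
  of matrices. The linear relations between them form an ideal stable under
  scaling, nonzero because matrices have finitely many entries. *)
Lemma conj_additive_trivial : Q = 1%:M.
Proof.
have [l [y [ly l0]]] := linear_relation A.
have A0 : A 0 = 1%:M by rewrite /A eqxx.
suff : A 1 - A 0 \in [pred X : 'M[k]_r | X == 0].
  by rewrite inE subr_eq0 A1 A0 => /eqP.
apply: (@augmentation_ideal k char0 F finF 'M[k]_r A _ _ _ _ l y 1 ly); last by rewrite inE l0.
- by split=> [|a u v]; rewrite !inE ?eqxx // => /eqP -> /eqP ->; rewrite scaler0 addr0.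
- move=> {l y ly l0} l y; rewrite !inE => /eqP l0.
  suff -> : lsum (fun x => A (x + y)) l = lsum A l *m A y by rewrite l0 mul0mx.
  by rewrite mulmx_suml; apply: eq_bigr => p _; rewrite -AD scalemxAl.
- move=> {l y ly l0} l t /exists_sqrt_neq0[d d0 <-]; rewrite !inE => /eqP l0.
  suff -> : lsum (fun x => A (d ^+ 2 * x)) l = L d^-1 *m lsum A l *m L d.
    by rewrite l0 mulmx0 mul0mx.
  rewrite mulmx_sumr mulmx_suml; apply: eq_bigr => p _.
  by rewrite A_scale // -scalemxAr -scalemxAl.
Qed.

End AdditiveConjugates.

(** * Eigenvectors behave as in a principal series *)

Section WeylOnCell.
Variables (k : fieldType) (char0 : [pchar k] =i pred0).
Variables (F : closedFieldType) (finF : locally_finite F).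
Variables (M : gmod k (SL2 F)) (D : cells M).
Implicit Types (n e w : M) (lam : {multiplicative torus F -> units k}).

Local Notation r := (rk D).
Local Notation co := (co D).
Local Notation eta := (eta D).
Local Notation wts := (wts D).
Local Notation E v := (emb eta v).
Local Notation Lam := (Lam D).
Local Notation Cf := (@Cf k F M D).
Implicit Types v : 'cV[k]_r.

Let m1 : -1 != 0 :> F. Proof. by rewrite oppr_eq0 oner_neq0. Qed.
Let V0 (d : F) : d != 0 -> d^-1 != 0. Proof. by rewrite invr_eq0. Qed.

Lemma emb_eig_sum v : exists m (e : 'I_m -> M),
  (forall i, eigenvector (e i)) /\ E v = \sum_i e i.
Proof.
exists r, (fun j => v j 0 *: eta j); split=> // j.
exists (wts j) => t; rewrite linearZ /=.
by have -> := eta_wt D j t; rewrite !scalerA mulrC.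
Qed.

Lemma co_SE x v : x != 0 -> co (U x (S (E v))) = 0.
Proof.
move=> x0; have [m [e [eP ->]]] := emb_eig_sum v.
rewrite !linear_sum; apply: big1 => i _; apply: co_eig => //; exact: eig_S.
Qed.

Lemma SV n : S (T (-1) (S n)) = n.
Proof. by rewrite ST // invrN1 SS TM // mulrNN mulr1 T1. Qed.

(** The Weyl element is invertible, so every fibre is hit. *)
Lemma Cf_onto v : exists v', Cf (-1) v' = v.
Proof.
pose n := T (-1) (S (U (-1) (E v))).
have Sn : U 1 (S n) = E v by rewrite SV UD addrN U0.
have [X [n0 [uX fn0 Dn XP]]] := co_dec D n.
exists (co (U (-1) n)).
have lin (f : {linear M -> 'cV[k]_r}) (g : F -> M) m :
    f (m + \sum_(y <- X) g y) = f m + \sum_(y <- X) f (g y).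
  by rewrite linearD linear_sum.
have := lin (co \o U 1 \o S : {linear _ -> _}) (fun y => U y (E (co (U (- y) n)))) n0.
rewrite /= -Dn Sn coE (co_S_ufix D fn0) ?oner_neq0 // add0r => ->.
have H y : y != 1 -> co (U 1 (S (U y (E (co (U (- y) n)))))) = 0.
  move=> y1; have [->|y0] := eqVneq y 0; first by rewrite U0 co_SE ?oner_neq0.
  have [t t0 Dt] := exists_sqrt_neq0 y0.
  rewrite -[1]opprK -{1}Dt Cf_scale // Cf_eq0 ?mulmx0 // mulrN1 Dt ?oppr_eq0 //.
  by rewrite eqr_opp.
have H1 (v1 : 'cV[k]_r) : co (U 1 (S (U 1 (E v1)))) = Cf (-1) v1 by rewrite /Cf opprK.
have [iX|niX] := boolP (1 \in X).
  by rewrite (bigD1_seq 1) //= big1 ?addr0 ?H1 // => y /H.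
rewrite XP // linear0 big1_seq // => y /andP[_ yX]; apply: H.
by apply: contra niX => /eqP <-.
Qed.

Definition Cm : 'M[k]_r := \matrix_(i, j) Cf (-1) (delta_mx j 0) i 0.

Lemma CmE v : Cm *m v = Cf (-1) v.
Proof.
rewrite {2}[v]matrix_sum_delta linear_sum; apply/matrixP => i j; rewrite (ord1 j) mxE summxE.
by apply: eq_bigr => h _; rewrite big_ord1 linearZ !mxE mulrC.
Qed.

Lemma mulmx_col_eq (A B : 'M[k]_r) : (forall v, A *m v = B *m v) -> A = B.
Proof.
move=> AB; apply/matrixP => i j; have := congr1 (fun X : 'cV_r => X i 0) (AB (delta_mx j 0)).
by rewrite -!colE !mxE.
Qed.

Lemma Cm_unit : Cm \in unitmx.
Proof.
have /choice[f fP] := fun j : 'I_r => Cf_onto (delta_mx j 0).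
pose B : 'M[k]_r := \matrix_(i, j) f j i 0.
suff /mulmx1_unit[] : Cm *m B = 1%:M by [].
apply/mulmx_col_eq => v; rewrite mul1mx -mulmxA CmE.
have -> : B *m v = \sum_j v j 0 *: f j.
  apply/matrixP => i j; rewrite (ord1 j) mxE summxE.
  by apply: eq_bigr => h _; rewrite !mxE mulrC.
rewrite linear_sum [RHS]matrix_sum_delta; apply: eq_bigr => j _.
by rewrite linearZ /= fP big_ord1.
Qed.

Lemma Cm_central : Cm *m Lam (-1) = Lam (-1) *m Cm.
Proof.
have sq1 : (-1) ^+ 2 = 1 :> F by rewrite sqrrN expr1n.
apply/mulmx_col_eq => v; rewrite -!mulmxA !CmE /Cf -TE //.
have TS w : T (-1) (S w) = S (T (-1) w) by rewrite ST // invrN1.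
by rewrite -coT // TU // TS TU // sq1 !mul1r.
Qed.

(** The two sides of [s u_x s u_1 = u_(-1/x) s h u_(1-1/x)] compared at the
  point [-1/(x-1)], with [x = a^2] and [x - 1 = b^2]. *)
Lemma Cm_rel a b : a != 0 -> b != 0 -> a ^+ 2 = b ^+ 2 + 1 ->
  Cm *m Lam b^-1 *m Cm = Lam a^-1 *m Cm *m Lam b^-1 *m Lam (-1) *m Lam a.
Proof.
move=> a0 b0 ab.
pose Y := - b ^- 2.
have b20 : b ^+ 2 != 0 by rewrite expf_neq0.
have a20 : a ^+ 2 != 0 by rewrite expf_neq0.
have Y0 : Y != 0 by rewrite oppr_eq0 invr_eq0.
have t0 : a * b != 0 by rewrite mulf_neq0.
have Dt : (a * b) ^+ 2 = (a ^+ 2) ^+ 2 - a ^+ 2 by rewrite exprMn ab; ring.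
apply/mulmx_col_eq => v.
have := Cf_right Y v a20 t0 Dt.
have -> : (a * b) ^+ 2 * (Y + (a ^+ 2)^-1) = -1.
  have -> : (a * b) ^+ 2 * (Y + (a ^+ 2)^-1) = b ^+ 2 - a ^+ 2.
    by rewrite /Y; field; rewrite a0 b0.
  by rewrite ab; ring.
have [X [uX XP] ->] := Cf_left (a ^+ 2) v Y0.
have H y : y != -1 -> co (U (- Y) (S (U (a ^+ 2 + y) (E (Cf y v))))) = 0.
  move=> y1; have [->|y0] := eqVneq y 0; last by rewrite Cf_eq0 // !linear0.
  rewrite addr0 Cf_scale // Cf_eq0 ?mulmx0 // ?mulf_neq0 //.
  rewrite /Y mulrN eqr_opp -subr_eq0.
  have -> : a ^+ 2 * b ^- 2 - 1 = b ^- 2 by rewrite ab; field.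
  by rewrite invr_eq0.
have -> : \sum_(y <- X) co (U (- Y) (S (U (a ^+ 2 + y) (E (Cf y v))))) =
    co (U (- Y) (S (U (a ^+ 2 + -1) (E (Cf (-1) v))))).
  have [iX|niX] := boolP (-1 \in X).
    by rewrite (bigD1_seq (-1)) //= big1 ?addr0 // => y /H.
  rewrite [in RHS]XP // !linear0 big1_seq // => y /andP[_ yX]; apply: H.
  by apply: contra niX => /eqP <-.
have -> : a ^+ 2 + -1 = b ^+ 2 by rewrite ab addrK.
rewrite Cf_scale //.
have -> : b ^+ 2 * Y = -1 by rewrite /Y mulrN mulfV.
rewrite -!CmE => /(congr1 (mulmx (Lam b))).
rewrite !mulmxA LamV // mul1mx => ->.
rewrite invfM [a^-1 / b]mulrC -LamM ?V0 // !mulmxA LamV // mul1mx.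
congr (_ *m v); rewrite -!(mulmxA (Lam a^-1 *m Cm *m Lam b^-1)); congr (_ *m _).
rewrite !LamM ?V0 ?oppr_eq0 ?oner_neq0 //; congr (Lam _).
by field.
Qed.

(** [Cm_rel] says that [Lam (-1) *m Cm] generates an additive group of conjugates. *)
Lemma Cm_scalar : Cm = Lam (-1).
Proof.
have LL : Lam (-1) *m Lam (-1) = 1%:M by rewrite LamM // mulrNN mulr1 Lam1.
have Q1 : Lam (-1) *m Cm = 1%:M.
  apply: (@conj_additive_trivial k char0 F finF r Lam).
  - exact: Lam1.
  - by move=> d e; apply: LamM.
  - by rewrite unitmx_mul Cm_unit andbT; case: (mulmx1_unit LL).
  - by rewrite -mulmxA Cm_central.
  move=> a b a0 b0 ab; have := congr1 (fun X => X *m Lam b) (Cm_rel a0 b0 ab).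
  rewrite !mulmxA => R.
  have LC (c : F) : c != 0 -> Lam c *m Lam (-1) = Lam (-1) *m Lam c.
    by move=> c0; rewrite !LamM // mulrC.
  rewrite -Cm_central -(mulmxA Cm (Lam (-1))) -LC ?V0 //.
  rewrite !mulmxA -(mulmxA _ (Lam (-1)) (Lam (-1))) LL mulmx1 R.
  rewrite -!mulmxA; congr (_ *m _).
  rewrite (mulmxA (Lam (-1)) Cm) -Cm_central -mulmxA; congr (_ *m _).
  rewrite !LamM ?V0 ?mulf_neq0 ?V0 //; congr (Lam _).
  by field.
by rewrite -[Cm]mul1mx -LL -mulmxA Q1 mulmx1.
Qed.

(** The coefficient of [s u_x e] at the point [-1/x], where [s] carries [x]. *)
Lemma co_weyl lam e x : weight_space lam e -> x != 0 ->
  co (U x^-1 (S (U x e))) = (ev lam (-1) / ev lam x) *: co e.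
Proof.
move=> ew x0; have ee : eigenvector e by exists lam.
have fe := eig_dec D ee.
have [t t0 Dt] := exists_sqrt_neq0 x0.
have [f [De {}fe]] : exists f, e = f + E (co e) /\ ufix f.
  by exists (e - E (co e)); rewrite subrK.
have LE d : d != 0 -> Lam d *m co e = ev lam d *: co e.
  by move=> d0; rewrite -coT //; have /wtP -> := ew; rewrite // linearZ.
rewrite {1}De !linearD /= fe (co_S_ufix D fe) ?V0 // add0r.
rewrite -[x^-1]opprK -{2}Dt Cf_scale // Dt mulrN mulfV //.
rewrite -CmE Cm_scalar !(LE, =^~ scalemxAr) ?V0 // !scalerA; congr (_ *: _).
by rewrite -Dt expr2 evM // evV //; field; rewrite ev_neq0.
Qed.

(** On every torus eigenvector the Weyl element acts, up to vectors fixed by the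
  unipotent group, as it does on a principal series. *)
Lemma weyl_eig lam e x : weight_space lam e -> x != 0 ->
  ufix (S (U x e) - S e - (ev lam (-1) / ev lam x) *: U (- x^-1) e).
Proof.
move=> ew x0; have ee : eigenvector e by exists lam.
have fe := eig_dec D ee; have eSe := eig_S ee.
apply: (@ufix_co _ _ _ D) => y.
rewrite !linearB /= !linearZ /= UD.
have [->|y0] := eqVneq y 0.
  rewrite !U0 add0r (co_eig D ee) ?oppr_eq0 ?V0 // oppr0 scaler0 addr0.
  have mx0 : - x != 0 by rewrite oppr_eq0.
  have [lam' [Sew lamE]] := wt_S ew.
  have := co_weyl Sew mx0; rewrite SUS // invrN !opprK UK TU //.
  have /wtP -> := ew; rewrite // !linearZ /= expr2 mulfK // !lamE // invrK.
  rewrite -[- x]mulN1r evM // mulrA mulVf ?ev_neq0 // mul1r.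
  by move/(scalerI (ev_neq0 _ _)) ->; rewrite subrr.
rewrite (co_eig D eSe) // subr0; have [->|yx] := eqVneq y x^-1.
  by rewrite (co_weyl ew x0) subrr U0 scalerN subrr.
rewrite (co_eig D ee) ?subr_eq0 // oppr0 scaler0 addr0.
have [t t0 Dt] := exists_sqrt_neq0 x0.
have [f [De {}fe]] : exists f, e = f + E (co e) /\ ufix f.
  by exists (e - E (co e)); rewrite subrK.
rewrite {1}De !linearD /= fe (co_S_ufix D fe) // add0r.
rewrite -[y]opprK -Dt Cf_scale // Cf_eq0 ?mulmx0 // Dt mulrN ?oppr_eq0 ?mulf_neq0 //.
rewrite eqr_opp; apply: contra_neq yx => xy.
by apply: (mulfI x0); rewrite xy mulfV.
Qed.

End WeylOnCell.

(** * Submodules without vectors fixed by the unipotent group *)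

Notation smem := Defs.sub_mem.

Section SubmodBasics.
Variables (k F : fieldType) (M : gmod k (SL2 F)) (K : submod M).

Lemma submod_U x v : v \in smem K -> U x v \in smem K.
Proof. exact: sub_stable. Qed.
Lemma submod_T d v : v \in smem K -> T d v \in smem K.
Proof. exact: sub_stable. Qed.
Lemma submod_S v : v \in smem K -> S v \in smem K.
Proof. exact: sub_stable. Qed.

End SubmodBasics.

Section NoFixedVector.
Variables (k : fieldType) (char0 : [pchar k] =i pred0).
Variables (F : closedFieldType) (finF : locally_finite F).
Variables (M : gmod k (SL2 F)) (D : cells M) (K : submod M).
Hypothesis K_ufix : forall v, v \in smem K -> ufix v -> v = 0.

Local Notation r := (rk D).
Local Notation co := (co D).
Local Notation eta := (eta D).
Local Notation wts := (wts D).
Local Notation E v := (emb eta v).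

Let cf (f : M) (j : 'I_r) (y : F) : k := co (U (- y) f) j 0.

Let supp f := [set j | `[< exists y, cf f j y != 0 >]].

Let supp_eq0 f : f \in smem K -> supp f = set0 -> f = 0.
Proof.
move=> fK f0; apply: K_ufix => //; apply: (@ufix_co _ _ _ D) => x.
apply/matrixP => j i; rewrite (ord1 i) mxE; apply/eqP/negbNE/negP => nz.
have : j \in supp f by rewrite inE; apply/asboolP; exists (- x); rewrite /cf opprK.
by rewrite f0 inE.
Qed.

Let sum_pick (E : seq F) (a : F -> k) w : uniq E -> (forall z, z \notin E -> a z = 0) ->
  \sum_(z <- E | z == w) a z = a w.
Proof.
move=> uE aE; have [wE|wE] := boolP (w \in E).
  by rewrite -big_filter filter_pred1_uniq // big_seq1.
by rewrite aE // big1_seq // => z /andP[/eqP-> /(negP wE)].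
Qed.

Let sum_sep (E : seq F) (P : F -> F -> bool) (h : F -> F -> k) u w :
    uniq E -> u \in E -> w \in E ->
    {in E &, forall x z, P x z = (x == u) && (z == w)} ->
  \sum_(x <- E) \sum_(z <- E | P x z) h x z = h u w.
Proof.
move=> uE uEE wE PE; rewrite (bigD1_seq u) //= [X in _ + X]big1_seq ?addr0.
  rewrite big_seq_cond (eq_bigl (fun z => (z \in E) && (z == w))) => [|z].
    by rewrite -big_seq_cond -big_filter filter_pred1_uniq // big_seq1.
  by case zE : (z \in E) => //=; rewrite PE // eqxx.
move=> x /andP[xu xE]; apply: big1_seq => z /andP[Pxz zE].
by move: Pxz; rewrite PE // (negbTE xu).
Qed.

Let sum_cf (E : seq F) (c : F -> k) (u : F -> M) j y :
  cf (\sum_(x <- E) c x *: u x) j y = \sum_(x <- E) c x * cf (u x) j y.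
Proof.
rewrite /cf !linear_sum summxE; apply: eq_bigr => x _.
by rewrite !linearZ mxE.
Qed.

Let cfB u w a j y : cf (u - a *: w) j y = cf u j y - a * cf w j y.
Proof. by rewrite /cf !linearB /= [U _ (_ *: _)]linearZ /= linearZ !mxE. Qed.

Let cfT t f j y : t != 0 -> cf (T t f) j y = ev (wts j) t * cf f j (y / t ^+ 2).
Proof.
move=> t0; have t20 : t ^+ 2 != 0 by rewrite expf_neq0.
have -> : cf (T t f) j y = co (T t (U (- (y / t ^+ 2)) f)) j 0.
  by rewrite TU // mulrN mulrC divfK.
by rewrite coT // /Lam mul_diag_mx !mxE.
Qed.

Let cfU f j x y : cf (U x f) j y = cf f j (y - x).
Proof. by rewrite /cf UD opprB addrC. Qed.

(** The components [f_j] of a vector of [K] with as few nonzero components as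
  possible are proportional: eliminating [f_1] between [f] and its dilations
  [T t f] gives zero, and when the support of [f] lies in a finite subfield not
  containing [t^2], the convolutions involved separate into products. *)
Lemma proportional_components f : f \in smem K -> f != 0 ->
  exists f lam v (a : F -> k), [/\ f \in smem K, weight_space lam (E v), v != 0,
     (forall y, co (U (- y) f) = a y *: v) & exists y, a y != 0].
Proof.
have [m] := ubnP #|supp f|; elim: m f => // m IH f; rewrite ltnS => fm fK f0.
have [[g [gK g0 gf]]|min_f] :=
    pselect (exists g, [/\ g \in smem K, g != 0 & (#|supp g| < #|supp f|)%N]).
  by apply: (IH g) => //; apply: leq_trans fm.
have [j1 j1f] : exists j1, j1 \in supp f.
  by apply/set0Pn; apply: contra f0 => /eqP/(supp_eq0 fK) ->.
have [X [_ [_ _ _ XP]]] := co_dec D f.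
have [Es fE XE] := finF X.
have aE j z : z \notin Es -> cf f j z = 0.
  by move=> zE; rewrite /cf XP ?mxE //; apply: contra zE; apply: XE.
have uE : uniq Es by case: fE.
have EB : {in Es &, forall x y, x - y \in Es} by case: fE.
pose g t := (\sum_(x <- Es) cf f j1 x *: U (t ^+ 2 * x) f)
  - (ev (wts j1) t)^-1 *: (\sum_(x <- Es) cf f j1 x *: U x (T t f)).
have gK t : g t \in smem K.
  apply: rpredB; first by apply: rpred_sum => x _; apply/rpredZ/submod_U.
  by apply/rpredZ/rpred_sum => x _; apply/rpredZ/submod_U/submod_T.
have cfg t j y : t != 0 -> cf (g t) j y =
    \sum_(x <- Es) \sum_(z <- Es | y == z + t ^+ 2 * x) cf f j1 x * cf f j z
  - (ev (wts j) t / ev (wts j1) t) *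
    \sum_(x <- Es) \sum_(z <- Es | y == x + t ^+ 2 * z) cf f j1 x * cf f j z.
  move=> t0; have t20 : t ^+ 2 != 0 by rewrite expf_neq0.
  have -> : cf (g t) j y = cf (\sum_(x <- Es) cf f j1 x *: U (t ^+ 2 * x) f) j y
      - (ev (wts j1) t)^-1 * cf (\sum_(x <- Es) cf f j1 x *: U x (T t f)) j y.
    exact: cfB.
  rewrite !sum_cf; congr (_ - _).
    apply: eq_bigr => x _; rewrite -mulr_sumr cfU; congr (_ * _).
    rewrite -[LHS](sum_pick (y - t ^+ 2 * x) uE (aE j)).
    by apply: eq_bigl => z; apply/eqP/eqP => [->|->]; rewrite ?subrK ?addrK.
  rewrite [_ / ev _ _]mulrC -mulrA; congr (_ * _).
  rewrite mulr_sumr; apply: eq_bigr => x _.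
  rewrite cfU cfT // -mulr_sumr mulrCA; congr (_ * (_ * _)).
  rewrite -[LHS](sum_pick ((y - x) / t ^+ 2) uE (aE j)).
  by apply: eq_bigl => z; apply/eqP/eqP => [->|->]; [field|]; rewrite // addrC addKr mulrC mulKf.
have Kg t : t != 0 -> t ^+ 2 \notin Es -> forall j y, cf (g t) j y = 0.
  move=> t0 tE j y; suff -> : g t = 0 by rewrite /cf !linear0 mxE.
  apply/eqP/negbNE/negP => g0; case: min_f; exists (g t); split=> //.
    exact: gK.
  apply: proper_card; apply/properP; split.
    apply/subsetP => i; rewrite !inE => /asboolP[z]; apply: contraNT => /asboolPn nz.
    have a0 x : cf f i x = 0.
      by apply/eqP/negbNE/negP => ax; apply: nz; exists x.
    rewrite cfg // !big1 ?mulr0 ?subrr // => x _; apply: big1 => w _; by rewrite a0 mulr0.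
  exists j1 => //; rewrite inE; apply/asboolPn => -[z /negP]; apply.
  rewrite cfg // divff ?ev_neq0 // mul1r subr_eq0; apply/eqP.
  under eq_bigr do rewrite big_mkcond; rewrite exchange_big /=.
  under [RHS]eq_bigr do rewrite big_mkcond; apply: eq_bigr => x _; apply: eq_bigr => w _.
  by case: ifP => // _; rewrite mulrC.
(* At the point [e + t^2 e'] each convolution has a single term. *)
have sep t j e e' : t != 0 -> t ^+ 2 \notin Es -> e \in Es -> e' \in Es ->
    cf f j1 e' * cf f j e = ev (wts j) t / ev (wts j1) t * (cf f j1 e * cf f j e').
  move=> t0 tE eE e'E.
  have uniq_dec x z : x \in Es -> z \in Es -> e + t ^+ 2 * e' = z + t ^+ 2 * x ->
      (z = e) * (x = e').
    move=> xE zE H; have [xe|xe] := eqVneq x e'.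
      by split=> //; move: H; rewrite xe => /addIr.
    case/negP: tE; have -> : t ^+ 2 = (z - e) / (e' - x).
      apply: (canRL (mulfK _)); first by rewrite subr_eq0 eq_sym.
      by rewrite mulrBr; apply/eqP; rewrite subr_eq addrAC -H; apply/eqP; ring.
    by case: fE => _ _ EB' EM EV; apply: EM; [apply: EB'|apply/EV/EB'].
  have := Kg t t0 tE j (e + t ^+ 2 * e'); rewrite cfg // => /eqP; rewrite subr_eq0 => /eqP.
  rewrite (@sum_sep Es _ _ e' e) // => [->|x z xE zE].
    rewrite (@sum_sep Es _ _ e e') // => x z xE zE.
    apply/eqP/andP => [H|[/eqP-> /eqP->]] //.
    by have [-> ->] := uniq_dec z x zE xE H.
  apply/eqP/andP => [H|[/eqP-> /eqP->]] //.
  by have [-> ->] := uniq_dec x z xE zE H.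
have [e0 e0f] : exists e0, cf f j1 e0 != 0 by move: j1f; rewrite inE => /asboolP.
have e0E : e0 \in Es by apply: contraNT e0f => /aE ->.
pose v : 'cV[k]_r := \col_j (cf f j e0 / cf f j1 e0).
have [t tt tE] : exists2 t, t != 0 & t ^+ 2 \notin Es.
  have [y] := notin_seq (0 :: Es); rewrite inE negb_or => /andP[y0 yE].
  by have [t t0 Dt] := exists_sqrt_neq0 y0; exists t; rewrite ?Dt.
have chi j s : v j 0 != 0 -> s != 0 -> s ^+ 2 \notin Es -> ev (wts j) s = ev (wts j1) s.
  rewrite mxE mulf_eq0 negb_or => /andP[aj0 _] s0 sE.
  have := sep s j e0 e0 s0 sE e0E e0E; rewrite -[LHS]mul1r => /mulIf.
  rewrite mulf_neq0 // => /(_ isT) /esym H.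
  by rewrite -[LHS](divfK (ev_neq0 (wts j1) s)) H mul1r.
have co_f y : co (U (- y) f) = cf f j1 y *: v.
  apply/matrixP => j i; rewrite (ord1 i) [RHS]mxE -[LHS]/(cf f j y).
  have [yE|yE] := boolP (y \in Es); last by rewrite (aE j y yE) (aE j1 y yE) mul0r.
  have := sep t j y e0 tt tE yE e0E.
  have [vj0|vj0] := eqVneq (v j 0) 0.
    have : cf f j e0 = 0.
      by apply/eqP; move/eqP: vj0; rewrite mxE mulf_eq0 invr_eq0 (negbTE e0f) orbF.
    by move=> Ej; rewrite vj0 mulr0 Ej !mulr0 => /eqP; rewrite mulf_eq0 (negbTE e0f) => /eqP.
  rewrite (chi j t) // divff ?ev_neq0 // mul1r => H.
  by rewrite mxE mulrA -H mulrAC mulfV // mul1r.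
exists f, (wts j1), v, (cf f j1); split=> //; last by exists e0.
- apply/wtP => d d0; rewrite TE // -linearZ; congr emb.
  apply/matrixP => j i; rewrite (ord1 i) mul_diag_mx !mxE -/(v j 0).
  have [y] := notin_seq (0 :: Es ++ [seq d ^+ 2 / x | x <- Es]).
  rewrite inE mem_cat !negb_or => /and3P[y0 yE dyE].
  have [s s0 Ds] := exists_sqrt_neq0 y0.
  have -> : cf f j e0 / cf f j1 e0 = v j 0 by rewrite mxE.
  have [->|vj0] := eqVneq (v j 0) 0; first by rewrite !mulr0.
  have [q [q0 qE ->]] : exists q, [/\ q != 0, q ^+ 2 \notin Es & d = q * s].
    exists (d / s); rewrite divfK // mulf_neq0 ?invr_eq0 //; split=> //.
    rewrite exprMn exprVn Ds; apply: contra dyE => dyE; apply/mapP.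
    exists (d ^+ 2 / y) => //; rewrite invfM invrK mulrA mulfV ?mul1r //.
    by rewrite expf_neq0.
  by rewrite !evM // !(chi j) // Ds.
apply: contra_neq (oner_neq0 k) => v0.
have : v j1 0 = 0 by rewrite v0 mxE.
by rewrite mxE divff.
Qed.

(** The vector with proportional components gives, up to a fixed vector, an element
  of the group algebra applied to a single eigenvector. *)
Lemma unip_differences f : f \in smem K -> f != 0 ->
  exists lam v, [/\ weight_space lam (E v), v != 0 &
    forall x, U x (E v) - E v \in smem K].
Proof.
move=> /proportional_components/[apply] -[{}f [lam [v [a [fK vw v0 fv [e0 e0f]]]]]].
exists lam, v; split=> // x; have [X [n0 [uX fn0 Df XP]]] := co_dec D f.
have aX y : y \notin X -> a y = 0.
  by move/XP; rewrite fv => /eqP; rewrite scaler_eq0 (negbTE v0) orbF => /eqP.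
apply: (@orbit_augmentation_mod k char0 F finF M (smem K) (E v) lam n0
  [seq (y, a y) | y <- X] e0) => //.
- exact: sub_closed.
- by move=> y w; apply: submod_U.
- by move=> d w _; apply: submod_T.
- by rewrite /lcoef big_map /= sum_pick.
suff <- : f = n0 + lsum (fun x => U x (E v)) [seq (y, a y) | y <- X] by [].
rewrite {1}Df /lsum big_map; congr (_ + _); apply: eq_bigr => y _.
by rewrite fv -linearZ /= -linearZ.
Qed.

(** Let [v] be an eigenvector whose differences lie in [K]. Applying [S] to
  [U 1 v - v] and translating back, [weyl_eig] puts into [K] a vector that differs
  from a multiple of [v] by a fixed one; having no fixed vector, [K] makes it an
  eigenvector [e], and turns [weyl_eig] for [e] into an equality. Evaluating
  [s u_x s u_1 e] in two ways then gives [S e = - e], whence a trivial weight. *)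
Lemma steinberg_vector f : f \in smem K -> f != 0 ->
  exists e, [/\ e \in smem K, e != 0, forall d, d != 0 -> T d e = e, S e = - e &
    forall x, x != 0 -> S (U x e) = U (- x^-1) e - e].
Proof.
move=> fK /(unip_differences fK)[lam [v [vw v0 vK]]].
pose eps := ev lam (-1).
have m1 : -1 != 0 :> F by rewrite oppr_eq0 oner_neq0.
have eps2 : eps * eps = 1 by rewrite -evM // mulrNN mulr1 ev1.
have eps0 : eps != 0 by apply: ev_neq0.
have fn := weyl_eig char0 finF D vw (oner_neq0 F).
set n := S (U 1 _) - _ - _ in fn; rewrite ev1 divr1 invr1 -/eps in n fn.
pose e := eps *: E v + n.
have eK : e \in smem K.
  have -> : e = S (U 1 (E v) - E v) - eps *: (U (-1) (E v) - E v).
    have SB a b : S (a - b) = S a - S b :> M by rewrite linearB.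
    by rewrite /e /n SB scalerBr opprB [RHS]addrCA.
  by rewrite rpredB ?rpredZ ?submod_S ?vK.
have ew : weight_space lam e.
  apply/wtP => d d0; apply/eqP; rewrite -subr_eq0; apply/eqP; apply: K_ufix.
    by rewrite rpredB ?rpredZ ?submod_T.
  have -> : T d e - ev lam d *: e = T d n - ev lam d *: n.
    rewrite /e linearD linearZ /=; have /wtP -> := vw => //.
    by rewrite scalerDr !scalerA mulrC opprD addrACA subrr add0r.
  by move=> x; rewrite linearB linearZ /= fn (ufixT d0 fn).
have e0 : e != 0.
  apply: contra_neq v0 => e0; have := congr1 co e0.
  rewrite linearD linearZ /= coE (co_ufix D fn) addr0 linear0 => H.
  by apply: (scalerI eps0); rewrite H scaler0.
clearbody e; have ewE := (wtP _ _).1 ew.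
have W x : x != 0 -> S (U x e) = S e + (eps / ev lam x) *: U (- x^-1) e.
  move=> x0; apply/eqP; rewrite -subr_eq0 opprD addrA; apply/eqP; apply: K_ufix.
    by rewrite !rpredB ?rpredZ ?submod_S ?submod_U ?submod_S.
  exact: (weyl_eig char0 finF D ew x0).
have SUSe x : x != 0 -> S (U x (S e)) = ev lam (- x) *: U (- x^-1) (S e) + eps *: e.
  move=> x0; have mx0 : - x != 0 by rewrite oppr_eq0.
  rewrite SUS // TU // ewE // sqrrN mulrN expr2 mulfK // !linearZ /= W //.
  rewrite invrN opprK linearD linearZ /= UK scalerDr scalerA; congr (_ + _ *: _).
  by rewrite mulrC divfK ?ev_neq0.
have Se : S e = - e.
  have [x] := @notin_seq F [:: 0; 1]; rewrite !inE negb_or => /andP[x0 x1].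
  have x10 : x - 1 != 0 by rewrite subr_eq0.
  have mx0 : - x != 0 by rewrite oppr_eq0.
  have := SUS (U 1 e) x0.
  rewrite W ?oner_neq0 // ev1 divr1 invr1 !linearD !linearZ /= SUSe // UD W //.
  rewrite (UD (- x^-1) 1) TU // ewE // !linearZ /= sqrrN.
  have -> : x ^+ 2 * (- x^-1 + 1) = x * (x - 1) by field.
  rewrite W ?mulf_neq0 // [U _ (_ + _)]linearD [U _ (_ *: _)]linearZ /= UD.
  have -> : - x^-1 - (x * (x - 1))^-1 = - (x - 1)^-1 by field; rewrite x0 x10.
  rewrite !scalerDr !scalerA evM // -[- x]mulN1r evM // -/eps.
  have -> : eps * ev lam x * (eps / (ev lam x * ev lam (x - 1))) = eps * (eps / ev lam (x - 1)).
    by field; rewrite !ev_neq0.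
  rewrite -!addrA => /addrI; rewrite !addrA => /eqP; rewrite -subr_eq0 addrK.
  by rewrite -scalerDr scaler_eq0 (negbTE eps0) /= addrC addr_eq0 => /eqP.
have ev_sq d : d != 0 -> ev lam d = ev lam d^-1.
  move=> d0; have di0 : d^-1 != 0 by rewrite invr_eq0.
  have := ST e d0; rewrite ewE // linearZ /= Se [T _ _]linearN /= ewE // scalerN => /oppr_inj.
  by move/eqP; rewrite -subr_eq0 -scalerBl scaler_eq0 (negbTE e0) orbF subr_eq0 => /eqP.
have ev_1 d : d != 0 -> ev lam d = 1.
  move=> /exists_sqrt_neq0[s s0 <-]; rewrite expr2 evM // {2}ev_sq // -evM ?invr_eq0 //.
  by rewrite mulfV // ev1.
exists e; split=> // [d d0|x x0]; first by rewrite ewE // ev_1 // scale1r.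
by rewrite W // /eps !ev_1 // divr1 scale1r Se addrC.
Qed.

End NoFixedVector.

(** * Induced modules *)

Section Quotient.
Variables (k : fieldType) (G : groupType) (M : gmod k G) (K : submod M).

Lemma quo_lift (W : lmodType k) (h : {linear M -> W}) :
    (forall v, v \in smem K -> h v = 0) ->
  exists f : {linear gmod_quo K -> W}, forall v, f (quo_pi K v) = h v.
Proof.
move=> h0; pose f (q : gmod_quo K) : W := h (repr (q : quo_sort K)).
have fE v : f (quo_pi K v) = h v.
  apply/eqP; rewrite -subr_eq0 -linearB; apply/eqP/h0.
  by apply/quo_piP; rewrite quo_piK.
have flin : linear f.
  move=> a x y; rewrite -[x](quo_piK (S := K)) -[y](quo_piK (S := K)).
  have -> : a *: (quo_pi K (repr x) : gmod_quo K) + quo_pi K (repr y) =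
    quo_pi K (a *: repr x + repr y) by rewrite linearP.
  by rewrite !fE linearP.
pose g : {linear gmod_quo K -> W} :=
  HB.pack f (GRing.isLinear.Build k (gmod_quo K) W *:%R f flin).
by exists g.
Qed.

End Quotient.

Section Balanced.
Variables (k : fieldType) (H G : groupType) (f : {multiplicative H -> G}).
Variables (V : gmod k H).

Lemma gact_tens g h (a : V) :
  gact g (tens h a : gmod_tens G V) = tens (g * h)%g a.
Proof.
apply/malgP => x; rewrite [LHS]gtens_actE !mcoeffU; congr (_ *+ nat_of_bool _).
by apply/eqP/eqP => [->|<-]; rewrite ?mulVKg ?mulKg.
Qed.

(** The span of the tensor relations is killed as soon as the relations are. *)
Lemma lin_balanced (W : lmodType k) (h : {linear gmod_tens G V -> W}) v :
    (forall g b (a : V), h (tens (g * f b)%g a) = h (tens g (gact b a))) ->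
  v \in smem (gspan (balanced f (V := V))) -> h v = 0.
Proof.
move=> hb /asboolP[n [c [e [eA ->]]]]; rewrite linear_sum big1 // => i _.
rewrite linearZ /=.
have [g [a [[x [b [w ->]]] De]]] := eA i.
have {}De : e i = tens (g * x * f b)%g w - tens (g * x)%g (gact b w).
  by rewrite De -mulgA -!gact_tens; exact: (linearB (gact g)).
have -> : h (e i) = h (tens (g * x * f b)%g w) - h (tens (g * x)%g (gact b w)).
  by rewrite De; exact: (linearB h).
by rewrite hb subrr scaler0.
Qed.

End Balanced.

Lemma weyl_translate (k F : fieldType) (M : gmod k (SL2 F)) (f : {linear M -> k^o}) :
  exists g : {linear M -> k^o}, forall v, g v = f (T (-1) (S v)).
Proof. by exists (f \o T (-1) \o S : {linear M -> k^o}). Qed.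

(** By the Bruhat decomposition a module generated by a vector on which the Borel
  subgroup acts by a character is spanned by it and by the cell of the Weyl element. *)
Lemma bruhat_dec (k F : fieldType) (M : gmod k (SL2 F)) (one : M)
    (theta : {multiplicative torus F -> units k}) :
    (forall x, U x one = one) -> (forall d, d != 0 -> T d one = ev theta d *: one) ->
  forall l : seq (SL2 F * k), exists a l',
    \sum_(p <- l) p.2 *: gact p.1 one = a *: one + lsum (fun x => U x (S one)) l'.
Proof.
move=> U_one T_one; elim=> [|[g c] l [a [l' IH]]].
  by exists 0, [::]; rewrite big_nil /lsum big_nil scale0r addr0.
rewrite big_cons IH /=; have [/eqP g10|g10] := boolP (g 1 0 == 0).
  have [d [x [d0 -> _]]] := borel_dec g10.
  exists (c * ev theta d + a), l'.
  by rewrite gactM -/(T d) T_one // linearZ /= -/(U x) U_one scalerA scalerDl addrA.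
have [d [x [y [d0 ->]]]] := bruhat g10.
exists a, ((x, ev theta d * c) :: l').
rewrite !gactM -/(U x) -/(U y) -/(T d) -/S U_one T_one // !linearZ /= scalerA.
by rewrite /lsum big_cons /= addrCA.
Qed.

Section Induced.
Variables (k F : fieldType) (theta : {multiplicative torus F -> units k}).
Local Notation G := (SL2 F).
Local Notation V := (gmod_res (@borel_torus F) (gmod_char theta)).
Local Notation tens := (@tens k (borel F) G V).
Local Notation ind_tens := (@ind_tens k (borel F) G (@borel_incl F) V).

Definition ind_one : M_theta theta := ind_tens 1%g (1 : k^o).

Section Lift.
Variables (W : lmodType k) (kap : G -> W).
Hypothesis kapB : forall g (b : borel F),
  kap (g * val b)%g = val (theta (borel_torus b)) *: kap g.

Definition tens_lift (t : gmod_tens G V) : W :=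
  \sum_(x <- msupp t) (mcoeff x t : k) *: kap x.

Lemma tens_lift_sub (t : gmod_tens G V) (d : {fset G}) : (msupp t `<=` d)%fset ->
  tens_lift t = \sum_(x <- d) (mcoeff x t : k) *: kap x.
Proof.
move=> td; apply: big_fset_incl => // x _ /mcoeff_outdom ->.
exact: scale0r.
Qed.

Fact tens_lift_linear : linear tens_lift.
Proof.
move=> a s t; pose d := (msupp s `|` msupp t `|` msupp (a *: s + t))%fset.
have ds : (msupp s `<=` d)%fset by rewrite /d -fsetUA fsubsetUl.
have dt : (msupp t `<=` d)%fset.
  by apply: fsubset_trans (fsubsetUl _ _); rewrite fsubsetUr.
rewrite (tens_lift_sub ds) (tens_lift_sub dt) (tens_lift_sub (d := d)) ?fsubsetUr //.
rewrite scaler_sumr -big_split; apply: eq_bigr => x _ /=.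
have -> : mcoeff x (a *: s + t) = a * mcoeff x s + mcoeff x t :> k.
  by rewrite mcoeffD; congr (_ + _); exact: (@gtens_scaleE k (borel F) G V a s x).
by rewrite scalerDl scalerA.
Qed.

HB.instance Definition _ :=
  GRing.isLinear.Build k (gmod_tens G V) W *:%R tens_lift tens_lift_linear.

Lemma tens_liftU g (a : k^o) : tens_lift (tens g a) = a *: kap g.
Proof.
rewrite (tens_lift_sub (d := [fset g]%fset)) ?msuppU_le // big_seq_fset1.
by rewrite mcoeffUU.
Qed.

Lemma tens_lift_balanced v : v \in smem (gspan (@balanced k (borel F) G (@borel_incl F) V)) ->
  tens_lift v = 0.
Proof.
apply: (lin_balanced (h := tens_lift)) => g b a.
apply: etrans (tens_liftU _ _) (etrans _ (esym (tens_liftU _ _))).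
by rewrite kapB scalerA mulrC.
Qed.

(** Frobenius reciprocity, for functions on the group that transform by [theta]
  under the Borel subgroup. *)
Lemma ind_lift : exists f : {linear M_theta theta -> W},
  forall g (a : k^o), f (ind_tens g a) = a *: kap g.
Proof.
have [f fE] := @quo_lift k G _ _ W (tens_lift : {linear gmod_tens G V -> W}) tens_lift_balanced.
by exists f => g a; rewrite [LHS]fE; exact: tens_liftU.
Qed.

End Lift.

Lemma gact_ind g h (a : k^o) : gact g (ind_tens h a : M_theta theta) = ind_tens (g * h)%g a.
Proof. by rewrite [LHS]quo_actE gact_tens. Qed.

Lemma gact_one g : gact g ind_one = ind_tens g (1 : k^o).
Proof.
by have := gact_ind g 1%g (1 : k^o); rewrite mulg1.
Qed.

Lemma ind_tensE g (a : k^o) : ind_tens g a = a *: gact g ind_one.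
Proof.
rewrite gact_one.
have E : tens g a = @gtens_scale k (borel F) G V a (tens g (1 : k^o)).
  apply/malgP => x; rewrite [RHS]gtens_scaleE [LHS]mcoeffU [in RHS]mcoeffU.
  by rewrite -scalerMnr; congr (_ *+ _); rewrite [RHS]mulr1.
have := quo_scaleE (gspan (balanced (@borel_incl F) (V := V))) a (tens g (1 : k^o)).
by rewrite /Defs.ind_tens E => <-.
Qed.

Lemma ind_dec_tens (v : M_theta theta) :
  exists l : seq (G * k), v = \sum_(p <- l) p.2 *: gact p.1 ind_one.
Proof.
pose t := repr (v : quo_sort (gspan (balanced (@borel_incl F) (V := V)))).
exists [seq (x, mcoeff x t : k) | x <- msupp t].
rewrite big_map -[LHS]quo_piK -/t {1}[t]monalgE.
transitivity (\sum_(x <- msupp t) (ind_tens x (mcoeff x t) : M_theta theta)).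
  exact: (raddf_sum (@quo_pi k G _ _)).
by apply: eq_bigr => x _; rewrite ind_tensE.
Qed.

Lemma gact_borel_one (b : borel F) :
  gact (val b) ind_one = val (theta (borel_torus b)) *: ind_one.
Proof.
rewrite -[in RHS](gact1 ind_one) -ind_tensE gact_one; apply/quo_piP.
apply/asboolP; exists 1%N, (fun=> 1), (fun=> tens (val b) (1 : k^o)
  - tens 1%g (val (theta (borel_torus b)) : k^o)); split=> [_|].
  exists 1%g, (tens (1 * val b)%g (1 : k^o) - tens 1%g (val (theta (borel_torus b)) : k^o)).
  split; last by rewrite gact1 mul1g.
  exists 1%g, b, (1 : k^o); congr (_ - tens 1%g _).
  by rewrite /= /char_act [RHS]mulr1.
by rewrite big_ord1 scale1r.
Qed.

Lemma U_one x : U x ind_one = ind_one.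
Proof.
have := gact_borel_one (upB x); have [d [y [d0 Db Dt Dd]]] := borelE (upB x).
rewrite Dt; have -> : d = 1 by rewrite Dd; case: (upE x).
by rewrite torT1 mult1 scale1r.
Qed.

Lemma T_one d : d != 0 -> T d ind_one = ev theta d *: ind_one.
Proof.
move=> d0; have := gact_borel_one (torB d).
have [e [y [e0 Db Dt De]]] := borelE (torB d).
by rewrite Dt; have -> : e = d by rewrite De; case: (torE d0).
Qed.

Lemma ind_dec (v : M_theta theta) :
  exists a l, v = a *: ind_one + lsum (fun x => U x (S ind_one)) l.
Proof.
have [l ->] := ind_dec_tens v.
exact: (bruhat_dec U_one T_one).
Qed.

(** The function on the group supported on the Borel subgroup, where it is [theta]. *)
Definition kap_inf (g : G) : k^o := if g 1 0 == 0 then ev theta (g 0 0) else 0.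

Fact kap_infB g (b : borel F) :
  kap_inf (g * val b)%g = val (theta (borel_torus b)) *: kap_inf g.
Proof.
have [d [x [d0 _ -> Dd]]] := borelE b; have /eqP b10 := valP b.
rewrite /kap_inf !sl2_mulE b10 -Dd !mulr0 !addr0 mulf_eq0 (negbTE d0) orbF.
case: eqP => [g10|_]; last by rewrite scaler0.
have := sl2_detE g; rewrite g10 mulr0 subr0 => gd.
have g0 : g 0 0 != 0.
  by apply/eqP => E; move: gd; rewrite E mul0r => /eqP; rewrite eq_sym oner_eq0.
by rewrite evM // mulrC.
Qed.

(** [ci] is the coefficient at the generator, i.e. at the point at infinity of
  the projective line; [c0] is the coefficient at the origin of the cell. *)
Lemma ind_coord : exists (ci c0 : {linear M_theta theta -> k^o}),
  [/\ ci ind_one = 1, forall x, ci (U x (S ind_one)) = 0, c0 ind_one = 0 &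
      forall x, c0 (U x (S ind_one)) = (x == 0)%:R].
Proof.
have [ci ciE] := @ind_lift k^o kap_inf kap_infB.
have ci_g g : ci (gact g ind_one) = kap_inf g.
  by rewrite -[gact g _]scale1r -ind_tensE ciE scale1r.
have m1 : -1 != 0 :> F by rewrite oppr_eq0 oner_neq0.
have [c0 c0E] := weyl_translate ci.
exists ci, c0.
have [w00 w01 w10 w11] := weylE F.
have [t00 t01 t10 t11] := torE m1.
split=> [|x||x].
- by rewrite -[ind_one]gact1 ci_g /kap_inf !sl2_oneE /= eqxx ev1.
- have [u00 u01 u10 u11] := upE x.
  rewrite /U /S -gactM ci_g /kap_inf !sl2_mulE u10 u11 w10 mul0r add0r mul1r.
  by rewrite oppr_eq0 oner_eq0.
- rewrite c0E /T /S -gactM ci_g /kap_inf !sl2_mulE t10 t11 w10 mul0r add0r.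
  by rewrite mulf_eq0 invr_eq0 oppr_eq0 oner_eq0.
rewrite c0E; have [->|x0] := eqVneq x 0.
  rewrite U0 SS TM // mulrNN mulr1 T1 -[ind_one]gact1.
  by rewrite ci_g /kap_inf !sl2_oneE /= eqxx ev1.
have [u00 u01 u10 u11] := upE x.
rewrite /T /S /U -!gactM ci_g /kap_inf !sl2_mulE t10 t11 w10 w11 w00 w01 u10 u11 u00 u01.
rewrite !(mul0r, add0r, mulr0, addr0, mul1r, mulr1, mulrN1, mulN1r) ?mulrNN.
by rewrite mulNr opprK mulf_eq0 invr_eq0 (negbTE m1) (negbTE x0).
Qed.

End Induced.

(** * Membership in the category *)

Lemma lsum_eq (k F : fieldType) (W : lmodType k) (Q : F -> W) l l' :
  (forall y, lcoef l y = lcoef l' y) -> lsum Q l = lsum Q l'.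
Proof.
move=> ll'; apply/eqP; rewrite -subr_eq0 -scaleN1r -lsum_scale -lsum_cat.
rewrite lsum_lcoef big1 // => y _.
by rewrite lcoef_cat (@lcoef_scale k F k^o) ll' scaleN1r subrr scale0r.
Qed.

Section Membership.
Variables (k : fieldType) (F : closedFieldType) (M : gmod k (SL2 F)).
Implicit Types (xi v : M).

Definition spans xi := forall v, exists l, v = lsum (fun x => U x xi) l.

Lemma ufree_coord (f : {linear M -> k^o}) (a : k) xi : a != 0 ->
  (forall x, f (U x xi) = if x == 0 then a else 0) -> ufree xi.
Proof.
move=> a0 fE l l0 y; apply: (mulIf a0); rewrite mul0r.
have <- : f (U (- y) (lsum (fun x => U x xi) l)) = 0 by rewrite l0 !linear0.
rewrite /lsum !linear_sum /lcoef mulr_suml big_mkcond; apply: eq_bigr => p _ /=.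
rewrite !linearZ /= UD fE addrC subr_eq0.
by case: eqP => _; rewrite ?scaler0.
Qed.

(** In a free cyclic module the only eigenvectors are the multiples of the
  generator: the torus moves every point but the origin along an infinite orbit. *)
Lemma ufree_eig lam xi v l : ufree xi -> weight_space lam xi -> v = lsum (fun x => U x xi) l ->
  eigenvector v -> v = lcoef l 0 *: xi.
Proof.
move=> fxi /wtP xiw Dv [mu /wtP vw].
suff l0 y : y != 0 -> lcoef l y = 0.
  rewrite Dv (@lsum_eq _ _ _ _ l [:: (0, lcoef l 0)]) => [|y].
    by rewrite /lsum big_seq1 U0.
  rewrite {2}/lcoef big_cons big_nil /= addr0 eq_sym.
  by case: eqP => [-> //|/eqP/l0].
move=> y0; have [z] := notin_seq (0 :: unzip1 l).
rewrite inE negb_or => /andP[z0 zl].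
have [d d0 Dd] : exists2 d, d != 0 & d ^+ 2 = z / y.
  by apply: exists_sqrt_neq0; rewrite mulf_neq0 ?invr_eq0.
have E : lsum (fun x => U x xi) [seq (d ^+ 2 * p.1, ev lam d * p.2) | p <- l] =
    lsum (fun x => U x xi) [seq (p.1, ev mu d * p.2) | p <- l].
  rewrite lsum_scale -Dv -vw // Dv [RHS]linear_sum /lsum big_map; apply: eq_bigr => p _ /=.
  by rewrite linearZ /= TU // xiw // [U _ (_ *: _)]linearZ scalerA mulrC.
have := ufree_inj z fxi E; rewrite (@lcoef_scale k F k^o) (lcoef_notin zl) scaler0.
rewrite /lcoef big_map /= -mulr_sumr => /eqP.
rewrite mulf_eq0 (negbTE (ev_neq0 _ _)) /= => /eqP E0.
have Dz : z = d ^+ 2 * y by rewrite Dd divfK.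
by rewrite -[RHS]E0; apply: eq_bigl => p; rewrite Dz (inj_eq (mulfI _)) // expf_neq0.
Qed.

(** Commuting projections onto the submodules generated by torus eigenvectors
  exhibit the direct sum decomposition; the eigenvectors of a free summand are
  the multiples of its generator, so that the torus part has the right dimension. *)
Lemma in_C_intro n (xi : 'I_n -> M) (pr : 'I_n -> {linear M -> M}) :
    (forall i, eigenvector (xi i)) ->
    (forall i x v, pr i (U x v) = U x (pr i v)) ->
    (forall i d v, d != 0 -> pr i (T d v) = T d (pr i v)) ->
    (forall v, v = \sum_i pr i v) ->
    (forall i v, exists l, pr i v = lsum (fun x => U x (xi i)) l) ->
    (forall i j, pr i (xi j) = if i == j then xi j else 0) ->
    (forall i, ufree (xi i) \/ ufix (xi i) /\ xi i <> 0) ->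
  in_C M.
Proof.
move=> xi_eig prU prT pr_sum pr_span pr_xi xi_free.
have xi0 i : xi i != 0.
  apply/eqP => xi0; case: (xi_free i) => [fxi|[]] //.
  have := fxi [:: (0, 1)]; rewrite /lsum big_seq1 xi0 linear0 scaler0 => /(_ erefl 0).
  by rewrite /lcoef big_cons big_nil eqxx addr0 => /eqP; rewrite oner_eq0.
have pr_sumE (c : 'I_n -> k) i : pr i (\sum_j c j *: xi j) = c i *: xi i.
  rewrite linear_sum (bigD1 i) //= big1 => [|j ji].
    by rewrite linearZ /= pr_xi eqxx addr0.
  by rewrite linearZ /= pr_xi eq_sym (negbTE ji) scaler0.
have eig_mult i v : eigenvector v -> exists c, pr i v = c *: xi i.
  move=> [lam /wtP vw]; have [l Dl] := pr_span i v.
  have pe : eigenvector (pr i v).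
    by exists lam; apply/wtP => d d0; rewrite -prT // vw // linearZ.
  case: (xi_free i) => [fxi|[fxi _]].
    have [mu xiw] := xi_eig i.
    by exists (lcoef l 0); apply: (ufree_eig fxi xiw Dl pe).
  exists (\sum_(p <- l) p.2); rewrite Dl scaler_suml.
  by apply: eq_bigr => p _; rewrite fxi.
exists n; split.
  exists xi; split=> [c c0 i|v].
    have := pr_sumE c i; rewrite c0 linear0 => /esym/eqP.
    by rewrite scaler_eq0 (negbTE (xi0 i)) orbF => /eqP.
  split=> [[m [c [e [eE ->]]]]|[c ->]]; last by exists n, c, xi.
  have /choice[a aE] : forall j, exists a : 'I_n -> k, forall i, pr i (e j) = a i *: xi i.
    move=> j; have /choice[a aE] := fun i => eig_mult i (e j) (eE j).
    by exists a.
  exists (fun i => \sum_j c j * a j i); rewrite [LHS]pr_sum; apply: eq_bigr => i _.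
  rewrite linear_sum scaler_suml; apply: eq_bigr => j _.
  by rewrite linearZ /= aE scalerA.
exists xi; split=> //.
pose phi v : {ffun 'I_n -> M} := [ffun i => pr i v].
have phi_lin : linear phi.
  by move=> a u v; apply/ffunP => i; rewrite !ffunE linearP.
pose phiL : {linear gmod_res (@borel_incl F) M -> gmod_pow n (gmod_res (@borel_incl F) M)} :=
  HB.pack phi (GRing.isLinear.Build k (gmod_res (@borel_incl F) M)
    (gmod_pow n (gmod_res (@borel_incl F) M)) *:%R phi phi_lin).
exists phiL; split.
- move=> b v; have [d [x [d0 -> _ _]]] := borelE b; rewrite !gactM.
  apply/ffunP => i; rewrite !ffunE.
  have HU y u : gact (upB y) (u : gmod_res (@borel_incl F) M) = U y u by [].
  have HT y u : gact (torB y) (u : gmod_res (@borel_incl F) M) = T y u by [].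
  by rewrite !HU !HT prU prT.
- move=> u v uv; rewrite [u]pr_sum [v]pr_sum; apply: eq_bigr => i _.
  by have /ffunP/(_ i) := uv; rewrite !ffunE.
move=> x; split=> [[v <-] i|xE].
  by rewrite ffunE; apply/unip_spanP; apply: pr_span.
exists (\sum_i x i); apply/ffunP => i; rewrite ffunE.
have prx j : pr i (x j) = if i == j then x j else 0.
  have /unip_spanP[l ->] := xE j; rewrite linear_sum /=; case: ifP => ij.
    by apply: eq_bigr => p _; rewrite linearZ /= prU pr_xi ij.
  by apply: big1 => p _; rewrite linearZ /= prU pr_xi ij linear0 scaler0.
rewrite linear_sum (bigD1 i) //= big1 ?addr0 => [|j ji]; rewrite prx ?eqxx //.
by rewrite eq_sym (negbTE ji).
Qed.

Lemma cyclic_in_C xi : eigenvector xi -> spans xi -> (ufree xi \/ ufix xi /\ xi <> 0) -> in_C M.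
Proof.
move=> xie sxi fxi.
apply: (@in_C_intro 1 (fun=> xi) (fun=> idfun : {linear M -> M})) => //.
- by move=> v; rewrite big_ord1.
- by move=> i j; rewrite (ord1 i) (ord1 j).
Qed.

End Membership.

(** * The irreducible modules *)

Definition irreducible_mod (k F : fieldType) (M : gmod k (SL2 F)) :=
  forall K : submod M, (exists2 v, v \in smem K & v != 0) -> forall v, v \in smem K.

Lemma lsum_smem (k F : fieldType) (M : gmod k (SL2 F)) (K : submod M) xi l :
  xi \in smem K -> lsum (fun x => U x xi) l \in smem K.
Proof. by move=> xiK; apply: rpred_sum => p _; apply/rpredZ/submod_U. Qed.

Section Principal.
Variables (k : fieldType) (F : closedFieldType).
Variables (M : gmod k (SL2 F)) (theta : {multiplicative torus F -> units k}).
Variables (one : M) (ci c0 : {linear M -> k^o}).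
Hypothesis one_U : forall x, U x one = one.
Hypothesis one_T : forall d, d != 0 -> T d one = ev theta d *: one.
Hypothesis dec : forall v, exists a l, v = a *: one + lsum (fun x => U x (S one)) l.
Hypothesis ci_one : ci one = 1.
Hypothesis ci_S : forall x, ci (U x (S one)) = 0.
Hypothesis c0_S : forall x, c0 (U x (S one)) = (x == 0)%:R.

Let one_neq0 : one != 0.
Proof. by apply/eqP => E; have := ci_one; rewrite E linear0 => /esym/eqP; rewrite oner_eq0. Qed.

Let Sone_wt : exists lam, weight_space lam (S one).
Proof. by have [] := @eig_S _ _ _ one; [exists theta; apply/wtP|move=> lam; exists lam]. Qed.

Let Sone_free : ufree (S one).
Proof.
apply: (ufree_coord (f := c0) (oner_neq0 k)) => x.
by rewrite c0_S; case: eqP.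
Qed.

Lemma principal_in_C : in_C M.
Proof.
pose p0 v : M := ci v *: one.
have p0l : linear p0 by move=> a u v; rewrite /p0 linearP scalerDl scalerA.
pose p0L : {linear M -> M} := HB.pack p0 (GRing.isLinear.Build k M M *:%R p0 p0l).
pose p1 v : M := v - p0 v.
have p1l : linear p1.
  by move=> a u v; rewrite /p1 p0l scalerBr opprD addrACA.
pose p1L : {linear M -> M} := HB.pack p1 (GRing.isLinear.Build k M M *:%R p1 p1l).
pose xi (i : 'I_2) := if i == 0 then one else S one.
pose pr (i : 'I_2) : {linear M -> M} := if i == 0 then p0L else p1L.
have ci_l l : ci (lsum (fun x => U x (S one)) l) = 0.
  by rewrite linear_sum big1 // => p _; rewrite linearZ /= ci_S scaler0.
have ciU x v : ci (U x v) = ci v.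
  have [a [l ->]] := dec v; rewrite !linearD !linearZ /= one_U ci_l; congr (_ + _).
  rewrite !linear_sum big1 // => p _.
  by rewrite !linearZ /= UD ci_S scaler0.
have [lam /wtP Sw] := Sone_wt.
have ciT d v : d != 0 -> ci (T d v) = ev theta d * ci v.
  move=> d0; have [a [l ->]] := dec v.
  rewrite !linearD !linearZ /= one_T // ci_l !linearZ /= addr0.
  have -> : ci (T d (lsum (fun x => U x (S one)) l)) = 0.
    rewrite !linear_sum big1 // => p _.
    by rewrite !linearZ /= TU // Sw // !linearZ /= ci_S !scaler0.
  by rewrite addr0.
have p0U x v : p0 (U x v) = U x (p0 v) by rewrite /p0 ciU linearZ /= one_U.
have p0T d v : d != 0 -> p0 (T d v) = T d (p0 v).
  by move=> d0; rewrite /p0 ciT // linearZ /= one_T // scalerA mulrC.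
have ord2 (i : 'I_2) : i = 0 \/ i = 1.
  by case: i => [[|[|//]] ?]; [left | right]; apply: val_inj.
apply: (@in_C_intro k F M 2 xi pr).
- by move=> i; case: (ord2 i) => ->; [exists theta; apply/wtP|apply: Sone_wt].
- by move=> i x v; case: (ord2 i) => ->; rewrite /pr /= ?p0U // /p1 p0U linearB.
- by move=> i d v d0; case: (ord2 i) => ->; rewrite /pr /= ?p0T // /p1 p0T // linearB.
- by move=> v; rewrite big_ord_recl big_ord1 /pr /= /p1 addrC subrK.
- move=> i v; case: (ord2 i) => ->; rewrite /pr /xi /=.
    by exists [:: (0, ci v)]; rewrite /lsum big_seq1 U0.
  have [a [l Dv]] := dec v; exists l.
  have civ : ci v = a by rewrite Dv linearD linearZ /= ci_one ci_l addr0 [LHS]mulr1.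
  by rewrite /p1 /p0 civ {1}Dv addrC addKr.
- move=> i j; case: (ord2 i) => ->; case: (ord2 j) => ->; rewrite /pr /xi /= /p1 /p0 ?ci_one.
  + by rewrite scale1r.
  + by rewrite -[S one]U0 ci_S scale0r.
  + by rewrite scale1r subrr.
  + by rewrite -[X in ci X]U0 ci_S scale0r subr0.
move=> i; case: (ord2 i) => ->; [right|left] => //.
by split=> //; apply/eqP.
Qed.

End Principal.

(** For a nontrivial character, a submodule containing the differences of the cell
  contains, after applying the Weyl element, the vectors
  [theta (-1) *: (theta x *: s 1 - 1)] for all nonzero [x], hence [s 1]. *)
Lemma principal_irreducible (k : fieldType) (char0 : [pchar k] =i pred0)
    (F : closedFieldType) (finF : locally_finite F)
    (M : gmod k (SL2 F)) (theta : {multiplicative torus F -> units k}) (one : M) d :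
    (forall x, U x one = one) -> (forall d, d != 0 -> T d one = ev theta d *: one) ->
    (forall v, exists a l, v = a *: one + lsum (fun x => U x (S one)) l) ->
    d != 0 -> ev theta d != 1 ->
  irreducible_mod M.
Proof.
move=> one_U one_T dec d0 d1 K [v vK v0].
have m1 : -1 != 0 :> F by rewrite oppr_eq0 oner_neq0.
suff oneK : one \in smem K.
  move=> w; have [a [l ->]] := dec w.
  by rewrite rpredD ?rpredZ ?lsum_smem ?submod_S.
have [a [l Dv]] := dec v.
have [l0|/existsNP[y /eqP ly]] := pselect (forall y, lcoef l y = 0).
  have l1 : lsum (fun x => U x (S one)) l = 0.
    by rewrite lsum_lcoef big1 // => y _; rewrite l0 scale0r.
  rewrite l1 addr0 in Dv; have a0 : a != 0.
    by apply: contra_neq v0 => a0; rewrite Dv a0 scale0r.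
  by rewrite -(scalerK a0 one) -Dv rpredZ.
have [lam Sw] : eigenvector (S one) by apply: eig_S; exists theta; apply/wtP.
have difK x : U x (S one) - S one \in smem K.
  apply: (@orbit_augmentation_mod k char0 F finF M (smem K) (S one) lam (a *: one) l y) => //.
  - exact: sub_closed.
  - by move=> z w; apply: submod_U.
  - by move=> z w _; apply: submod_T.
  - by move=> z; rewrite linearZ /= one_U.
  - by rewrite -Dv.
have key x : x != 0 -> ev theta (- x) *: S one - ev theta (-1) *: one \in smem K.
  move=> x0; have mx0 : - x != 0 by rewrite oppr_eq0.
  have := submod_S (difK x).
  rewrite linearB /= SUS // one_U one_T // !linearZ /= SS one_T // => H.
  have := rpredB H (rpredZ (ev theta (- x)) (difK (- x^-1))).
  by rewrite scalerBr opprB addrC addrA subrK scalerN.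
have SoneK : S one \in smem K.
  have := rpredB (key d d0) (key 1 (oner_neq0 F)).
  rewrite opprB addrA subrK -scalerBl -[- d]mulN1r evM // -[X in _ - X]mulr1 -mulrBr.
  have c0 : ev theta (-1) * (ev theta d - 1) != 0 by rewrite mulf_neq0 ?ev_neq0 // subr_eq0.
  by move=> /(rpredZ (ev theta (-1) * (ev theta d - 1))^-1); rewrite scalerK.
have := submod_S SoneK; rewrite SS one_T // => /(rpredZ (ev theta (-1))^-1).
by rewrite scalerK ?ev_neq0.
Qed.

(** * The Steinberg module *)

Section Steinberg.
Variables (k : fieldType) (F : closedFieldType).

(** The relations between the translates of the difference of the points [oo] and
  [0] of the projective line. *)
Definition steinberg_relations (M : gmod k (SL2 F)) (e : M) : Prop :=
  [/\ forall d, d != 0 -> T d e = e, S e = - e &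
      forall x, x != 0 -> S (U x e) = U (- x^-1) e - e].

Lemma steinberg_of_fixed (M : gmod k (SL2 F)) (v : M) : ufix v ->
  (forall d, d != 0 -> T d v = v) -> steinberg_relations (v - S v).
Proof.
move=> vU vT; have m1 : -1 != 0 :> F by rewrite oppr_eq0 oner_neq0.
split=> [d d0||x x0].
- by rewrite linearB /= vT // -[d]invrK -ST ?invr_eq0 // vT ?invr_eq0.
- by rewrite linearB /= SS vT // opprB.
have mx0 : - x != 0 by rewrite oppr_eq0.
rewrite !linearB /= vU SUS // vU vT //.
by rewrite opprK addrACA subrr add0r addrC.
Qed.

Lemma ufree_difference (M : gmod k (SL2 F)) (v : M) (f : {linear M -> k^o}) :
    ufix v -> f v = 0 -> (forall x, f (U x (S v)) = (x == 0)%:R) ->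
  ufree (v - S v).
Proof.
move=> vU fv fS; apply: (ufree_coord (f := f) (a := -1)).
  by rewrite oppr_eq0 oner_neq0.
by move=> x; rewrite !linearB /= vU fv fS sub0r; case: eqP; rewrite ?oppr0.
Qed.

Lemma steinberg_irreducible (char0 : [pchar k] =i pred0) (finF : locally_finite F)
    (M : gmod k (SL2 F)) (e : M) :
  steinberg_relations e -> spans e -> irreducible_mod M.
Proof.
move=> [eT Se eU] espan K [v vK v0].
suff eK : e \in smem K by move=> w; have [l ->] := espan w; apply: lsum_smem.
have [l Dv] := espan v; have [y ly] : exists y, lcoef l y != 0.
  apply/not_existsP => l0; case/eqP: v0; rewrite Dv lsum_lcoef big1 // => y _.
  by have /negP := l0 y; rewrite negbK => /eqP ->; rewrite scale0r.
have [lam ew] : eigenvector e.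
  exists (triv_char k (torus F)); apply/wtP => d d0.
  by rewrite eT // /ev /= scale1r.
have := @orbit_augmentation k char0 F finF M (smem K) e lam l y 1 (sub_closed K)
  (fun x w => @submod_U _ _ _ K x w) (fun d w _ => @submod_T _ _ _ K d w) ew ly.
rewrite -Dv => /(_ vK) /submod_S; rewrite linearB /= eU ?oner_neq0 // Se opprK subrK.
by move=> /(submod_U 1^-1); rewrite UNK.
Qed.

(** A free generator allows any choice of the images of its translates. *)
Lemma ufree_lift (M : gmod k (SL2 F)) (e : M) (W : lmodType k) (Q : F -> W) :
  ufree e -> spans e -> exists f : {linear M -> W}, forall x, f (U x e) = Q x.
Proof.
move=> fe /choice[L LE]; pose f v := lsum Q (L v).
have fE v l : v = lsum (fun x => U x e) l -> f v = lsum Q l.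
  by move=> Dv; apply: lsum_eq => y; apply: (ufree_inj y fe); rewrite -LE.
have flin : linear f.
  move=> a u v; rewrite (fE _ ([seq (p.1, a * p.2) | p <- L u] ++ L v)).
    by rewrite lsum_cat lsum_scale.
  by rewrite lsum_cat lsum_scale -!LE.
pose g : {linear M -> W} := HB.pack f (GRing.isLinear.Build k M W *:%R f flin).
exists g => x; rewrite /= (fE _ [:: (x, 1)]) /lsum ?big_seq1 ?scale1r //.
Qed.

Lemma steinberg_hom (M N : gmod k (SL2 F)) (e : M) (e' : N) :
    steinberg_relations e -> ufree e -> spans e -> steinberg_relations e' ->
  exists f : {linear M -> N}, is_hom f /\ f e = e'.
Proof.
move=> [eT Se eU] fe se [eT' Se' eU'].
have [f fE] := ufree_lift (fun x => U x e') fe se.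
have fe1 : f e = e' by rewrite -[e]U0 fE U0.
exists f; split=> //; apply: gen_hom => [x v|d v d0|v]; have [l ->] := se v;
  rewrite !linear_sum; apply: eq_bigr => p _; rewrite !linearZ /=; congr (_ *: _).
- by rewrite -!UE UD fE -UD -fE.
- by rewrite -/(T d) TU // eT // !fE -/(T d) TU // eT'.
rewrite -/S fE; have [->|p0] := eqVneq p.1 0; first by rewrite !U0 Se linearN fe1 Se'.
by rewrite eU // linearB /= fE fe1 eU'.
Qed.

Section Generated.
Variables (M : gmod k (SL2 F)) (e : M).
Hypothesis rel_e : steinberg_relations e.

Local Notation K := (gspan (eq^~ e)).

Lemma gen_mem : e \in smem K.
Proof.
apply/asboolP; exists 1%N, (fun=> 1), (fun=> e); split=> [_|].
  by exists 1%g, e; rewrite gact1.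
by rewrite big_ord1 scale1r.
Qed.

Definition gen : gmod_sub K := exist _ e gen_mem.

(** The translates of [e] by the unipotent group already span the module it
  generates. *)
Lemma gen_gact g : exists l, gact g e = lsum (fun x => U x e) l.
Proof.
case: rel_e => eT Se eU.
have [/eqP g10|g10] := boolP (g 1 0 == 0).
  have [d [x [d0 -> _]]] := borel_dec g10.
  exists [:: (x, 1)].
  by rewrite gactM -/(T d) eT // /lsum big_seq1 scale1r.
have [d [x [y [d0 ->]]]] := bruhat g10.
rewrite !gactM -/(U y) -/(T d) -/S -/(U x) TU // eT //.
have [->|z0] := eqVneq (d ^+ 2 * y) 0.
  by exists [:: (x, -1)]; rewrite U0 Se /lsum big_seq1 scaleN1r linearN.
rewrite eU // linearB /= UD; eexists [:: (_, 1); (x, -1)].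
by rewrite /lsum big_cons big_seq1 scaleN1r scale1r.
Qed.

Lemma gen_spans : spans gen.
Proof.
move=> v; have [l Dv] : exists l, val v = lsum (fun x => U x e) l.
  have /asboolP[n [c [f [fE ->]]]] := valP v.
  have /choice[L LE] : forall i, exists l, f i = lsum (fun x => U x e) l.
    by move=> i; have [g [a [-> ->]]] := fE i; apply: gen_gact.
  exists (flatten [seq [seq (p.1, c i * p.2) | p <- L i] | i <- enum 'I_n]).
  rewrite /lsum big_flatten /= big_map big_enum; apply: eq_bigr => i _.
  by rewrite LE -lsum_scale.
exists l; apply: val_inj; rewrite Dv [RHS]raddf_sum; apply: eq_bigr => p _.
by [].
Qed.

Lemma gen_relations : steinberg_relations gen.
Proof.
case: rel_e => eT Se eU.
by split=> [d d0||x x0]; apply: val_inj; [exact: eT|exact: Se|exact: eU].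
Qed.

Lemma gen_ufree : ufree e -> ufree gen.
Proof.
move=> fe l l0; apply: fe; have /(congr1 val) := l0.
by rewrite [val (lsum _ _)]raddf_sum.
Qed.

End Generated.
End Steinberg.

(** * Maps from the listed modules *)

Section Listed.
Variables (k : fieldType) (char0 : [pchar k] =i pred0).
Variables (F : closedFieldType) (finF : locally_finite F).
Local Notation G := (SL2 F).

Definition nontrivial_char (theta : {multiplicative torus F -> units k}) :=
  exists t, theta t <> 1%g.

Definition listed (X : gmod k G) : Prop :=
  [\/ X = k_tr k F, X = St k F |
      exists2 theta, nontrivial_char theta & X = M_theta theta].

Lemma ev_triv (d : F) : ev (triv_char k (torus F)) d = 1.
Proof. by []. Qed.

Lemma nontrivial_ev theta : nontrivial_char theta <->
  exists2 d : F, d != 0 & ev theta d != 1.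
Proof.
split=> [[t tt]|[d d0 d1]].
  have [d d0 Dt] := torusE t; exists d => //; apply/eqP => d1; apply: tt.
  by rewrite Dt; apply: val_inj.
by exists (torT d) => t1; case/eqP: d1; rewrite /ev t1.
Qed.

Let steinberg_gen : M_tr k F := ind_one (triv_char k (torus F)) - S (ind_one (triv_char k (torus F))).

Lemma St_generator : exists e : St k F, [/\ steinberg_relations e, spans e & ufree e].
Proof.
have [ci [c0 [_ _ c0_one c0_S]]] := ind_coord (triv_char k (torus F)).
have rel : steinberg_relations steinberg_gen.
  apply: steinberg_of_fixed; first exact: U_one.
  by move=> d d0; rewrite T_one // ev_triv scale1r.
exists (gen steinberg_gen); split; first exact: gen_relations.
  exact: gen_spans.
apply: gen_ufree; apply: (ufree_difference _ c0_one c0_S).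
exact: U_one.
Qed.

Lemma M_theta_in_C theta : in_C (@M_theta k F theta).
Proof.
have [ci [c0 [ci_one ci_S c0_one c0_S]]] := ind_coord theta.
exact: (principal_in_C (@U_one _ _ theta) (@T_one _ _ theta) (@ind_dec _ _ theta) ci_one ci_S c0_S).
Qed.

Lemma steinberg_eig (M : gmod k G) (e : M) : steinberg_relations e -> eigenvector e.
Proof.
case=> eT _ _; exists (triv_char k (torus F)); apply/wtP => d d0.
by rewrite eT // ev_triv scale1r.
Qed.

Lemma k_tr_gact g (v : k_tr k F) : gact g v = v.
Proof. by rewrite /= /char_act /= scale1r. Qed.

Lemma listed_in_C X : listed X -> in_C X.
Proof.
case=> [->|->|[theta _ ->]]; last exact: M_theta_in_C.
  apply: (@cyclic_in_C k F (k_tr k F) (1 : k^o)).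
  - exists (triv_char k (torus F)); apply/wtP => d d0.
    by rewrite ev_triv scale1r; exact: k_tr_gact.
  - move=> v; exists [:: (0, v)]; rewrite /lsum big_seq1 U0 [RHS]mulr1 //.
  - right; split; first by move=> x; exact: k_tr_gact.
    by apply/eqP; exact: oner_neq0.
have [e [rel se fe]] := St_generator.
by apply: (cyclic_in_C (steinberg_eig rel) se); left.
Qed.

Lemma listed_irreducible X : listed X -> irreducible_mod X.
Proof.
case=> [->|->|[theta /nontrivial_ev[d d0 d1] ->]].
- move=> K [v vK v0] w.
  have -> : w = ((w : k^o) / (v : k^o)) *: v by rewrite [RHS]divfK.
  exact: rpredZ.
- have [e [rel se fe]] := St_generator.
  exact: (steinberg_irreducible char0 finF rel se).
exact: (principal_irreducible char0 finF (@U_one _ _ theta) (@T_one _ _ theta)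
  (@ind_dec _ _ theta) d0 d1).
Qed.

Lemma orbit_hom (M N : gmod k G) (one : M) (n : N) (f : {linear M -> N}) :
    (forall v, exists l : seq (G * k), v = \sum_(p <- l) p.2 *: gact p.1 one) ->
    (forall g, f (gact g one) = gact g n) ->
  is_hom f.
Proof.
move=> dec fE g v; have [l ->] := dec v.
rewrite !linear_sum; apply: eq_bigr => p _.
by rewrite !linearZ /= -gactM !fE gactM.
Qed.

Lemma M_theta_hom (N : gmod k G) (theta : {multiplicative torus F -> units k}) (n : N) :
    ufix n -> weight_space theta n ->
  exists f : {linear M_theta theta -> N}, is_hom f /\ f (ind_one theta) = n.
Proof.
move=> nU nT; have kB g (b : borel F) :
    gact (g * val b)%g n = val (theta (borel_torus b)) *: gact g n.
  have [d [x [d0 -> -> _]]] := borelE b.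
  have -> : val (upB x * torB d)%g = (up x * tor d)%g by [].
  rewrite !gactM -/(T d) -/(U x); have /wtP -> := nT => //.
  by rewrite [U x _]linearZ /= nU linearZ.
have [f fE] := @ind_lift k F theta N (fun g => gact g n) kB.
have fg g : f (gact g (ind_one theta)) = gact g n.
  by rewrite gact_one fE scale1r.
exists f; split; last by rewrite -[ind_one theta]gact1 fg gact1.
exact: (orbit_hom (@ind_dec_tens _ _ theta) fg).
Qed.

Lemma k_tr_hom (N : gmod k G) (n : N) : (forall g, gact g n = n) ->
  exists f : {linear k_tr k F -> N}, is_hom f /\ f (1 : k^o) = n.
Proof.
move=> nG; pose f (a : k_tr k F) : N := (a : k) *: n.
have fl : linear f by move=> a u v; rewrite /f scalerDl scalerA.
pose fL : {linear k_tr k F -> N} := HB.pack f (GRing.isLinear.Build k (k_tr k F) N *:%R f fl).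
exists fL; split; last exact: scale1r.
by move=> g v; rewrite k_tr_gact [RHS]linearZ /= nG.
Qed.

(** Induction on the number of eigenvectors in a sum: [T d - lam d] removes the last
  one and keeps the submodule. *)
Lemma fixed_eigenvector (M : gmod k G) (K : submod M) m (e : 'I_m -> M) :
    (forall i, eigenvector (e i)) -> \sum_i e i \in smem K -> ufix (\sum_i e i) ->
    \sum_i e i != 0 ->
  exists theta n, [/\ weight_space theta n, n \in smem K, ufix n & n != 0].
Proof.
elim: m e => [|m IH] e ee eK eU e0; first by rewrite big_ord0 eqxx in e0.
have [lam /wtP ew] := ee ord_max; set v := \sum_i e i in eK eU e0.
have [vw|] := pselect (forall d, d != 0 -> T d v = ev lam d *: v).
  by exists lam, v; split=> //; apply/wtP.
move=> /existsNP[d /not_implyP[d0 /eqP Td]].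
have /choice[c cE] : forall i, exists c, T d (e i) = c *: e i.
  by move=> i; have [mu /wtP ->] := ee i => //; exists (ev mu d).
have Dw : T d v - ev lam d *: v =
    \sum_(i < m) (c (widen_ord (leqnSn m) i) - ev lam d) *: e (widen_ord (leqnSn m) i).
  rewrite /v linear_sum big_ord_recr [X in _ - _ *: X]big_ord_recr /= ew // scalerDr.
  rewrite opprD addrACA subrr addr0 scaler_sumr -sumrB; apply: eq_bigr => i _.
  by rewrite cE scalerBl.
apply: (IH (fun i => (c (widen_ord (leqnSn m) i) - ev lam d) *: e (widen_ord (leqnSn m) i))).
- move=> i; have [mu /wtP muw] := ee (widen_ord (leqnSn m) i); exists mu.
  by apply/wtP => d' d'0; rewrite linearZ /= muw // !scalerA mulrC.
- by rewrite -Dw rpredB ?rpredZ ?submod_T.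
- by rewrite -Dw => x; rewrite linearB linearZ /= eU (ufixT d0 eU).
- by rewrite -Dw subr_eq0.
Qed.

(** A fixed eigenvector [n] of [K] of nontrivial weight spans a principal series. If
  the weight is trivial, either [n] is fixed by the whole group or [n - S n]
  spans a Steinberg module. Without fixed vectors, [steinberg_vector] applies. *)
Lemma listed_maps (N : gmod k G) (K : submod N) v : in_C N -> v \in smem K -> v != 0 ->
  exists (X : gmod k G) (g : {linear X -> N}) x, [/\ listed X, is_hom g, g x \in smem K & g x != 0].
Proof.
move=> /(in_C_cells char0 finF)[D _] vK v0.
have St_case e : e \in smem K -> e != 0 -> steinberg_relations e ->
    exists (X : gmod k G) (g : {linear X -> N}) x, [/\ listed X, is_hom g, g x \in smem K & g x != 0].
  move=> eK e0 rel; have [e1 [rel1 se1 fe1]] := St_generator.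
  have [g [gh ge]] := steinberg_hom rel1 fe1 se1 rel.
  by exists (St k F), g, e1; rewrite ge; split=> //; constructor 2.
have [K_ufix|/existsNP[n1]] := pselect (forall v, v \in smem K -> ufix v -> v = 0).
  have [e [eK e0 eT Se eU]] := steinberg_vector char0 finF D K_ufix vK v0.
  exact: (St_case e).
move=> /not_implyP[n1K /not_implyP[n1U /eqP n10]].
have [m [f [fP Dn1]]] := ufix_eigen D n1U.
have [theta [n [nw nK nU n0]]] : exists theta n,
    [/\ weight_space theta n, n \in smem K, ufix n & n != 0].
  rewrite Dn1 in n1K n1U n10; apply: (fixed_eigenvector (e := f)) => // i.
  by case: (fP i).
have [nt|triv] := pselect (nontrivial_char theta).
  have [g [gh gn]] := M_theta_hom nU nw.
  exists (M_theta theta), g, (ind_one theta); rewrite gn; split=> //.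
  by constructor 3; exists theta.
have nT d : d != 0 -> T d n = n.
  move=> d0; have /wtP -> := nw => //; have -> : ev theta d = 1; last by rewrite scale1r.
  apply/eqP; apply: contrapT => /negP d1; apply: triv.
  by apply/nontrivial_ev; exists d.
have [Sn|Sn] := eqVneq (n - S n) 0; last first.
  by apply: (St_case (n - S n)); rewrite ?rpredB ?submod_S //; apply: steinberg_of_fixed.
have {}Sn : S n = n by apply/esym/eqP; rewrite -subr_eq0 Sn.
have nG g : gact g n = n.
  have [/eqP g10|g10] := boolP (g 1 0 == 0).
    by have [d [x [d0 -> _]]] := borel_dec g10; rewrite gactM -/(T d) nT // -/(U x) nU.
  have [d [x [y [d0 ->]]]] := bruhat g10.
  by rewrite !gactM -/(U y) nU -/(T d) nT // -/S Sn -/(U x) nU.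
have [g [gh g1]] := k_tr_hom nG.
by exists (k_tr k F), g, (1 : k^o); rewrite g1; split=> //; constructor 1.
Qed.

End Listed.

(** * Simple objects *)

Section Simple.
Variables (k : fieldType) (char0 : [pchar k] =i pred0).
Variables (F : closedFieldType) (finF : locally_finite F).
Local Notation G := (SL2 F).

Lemma ker_closed (M N : gmod k G) (f : {linear M -> N}) :
  submod_closed [pred v | f v == 0].
Proof.
split=> [|a u v]; rewrite !inE ?linear0 ?eqxx // => /eqP fu /eqP fv.
by rewrite linearP fu fv scaler0 addr0.
Qed.

Fact ker_stable (M N : gmod k G) (f : {linear M -> N}) (fh : is_hom f) g v :
  v \in [pred v | f v == 0] -> gact g v \in [pred v | f v == 0].
Proof. by rewrite !inE fh => /eqP ->; rewrite linear0. Qed.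

Definition ker_submod (M N : gmod k G) (f : {linear M -> N}) (fh : is_hom f) : submod M :=
  Submod (ker_closed f) (ker_stable fh).

Lemma im_closed (M N : gmod k G) (f : {linear M -> N}) (K : submod M) :
  submod_closed [pred w | `[< exists2 v, v \in smem K & w = f v >]].
Proof.
split=> [|a u v]; first by apply/asboolP; exists 0; rewrite ?rpred0 ?linear0.
move=> /asboolP[x xK ->] /asboolP[y yK ->]; apply/asboolP.
by exists (a *: x + y); rewrite ?linearP // rpredD ?rpredZ.
Qed.

Fact im_stable (M N : gmod k G) (f : {linear M -> N}) (fh : is_hom f) (K : submod M) g w :
  w \in [pred w | `[< exists2 v, v \in smem K & w = f v >]] ->
  gact g w \in [pred w | `[< exists2 v, v \in smem K & w = f v >]].
Proof.
move=> /asboolP[v vK ->]; apply/asboolP; exists (gact g v); first exact: sub_stable.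
by rewrite fh.
Qed.

Definition im_submod (M N : gmod k G) (f : {linear M -> N}) (fh : is_hom f) (K : submod M) :
  submod N := Submod (im_closed f K) (im_stable fh (K := K)).

Lemma inj_of_irreducible (X M : gmod k G) (f : {linear X -> M}) x :
  irreducible_mod X -> is_hom f -> f x != 0 -> injective f.
Proof.
move=> irrX fh fx u v fuv; apply/eqP; rewrite -subr_eq0; apply: contraNT fx => uv.
have uvK : u - v \in smem (ker_submod fh) by rewrite inE linearB fuv subrr.
by have := irrX _ (ex_intro2 _ _ (u - v) uvK uv) x; rewrite inE.
Qed.

Lemma surj_of_irreducible (N M : gmod k G) (f : {linear N -> M}) x :
  irreducible_mod M -> is_hom f -> f x != 0 -> forall w, exists v, w = f v.
Proof.
move=> irrM fh fx w.
have allC : submod_closed (predT : {pred N}) by split.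
pose K := Submod allC (fun g v (_ : v \in predT) => isT : gact g v \in predT).
have fxK : f x \in smem (im_submod fh K) by apply/asboolP; exists x.
by have /asboolP[v _ ->] := irrM _ (ex_intro2 _ _ (f x) fxK fx) w; exists v.
Qed.

Lemma bij_of_inj_surj (A B : Type) (f : A -> B) :
  injective f -> (forall w, exists v, w = f v) -> bijective f.
Proof.
move=> fi /choice[g gE]; exists g => [v|w]; last by rewrite -gE.
by apply: fi; rewrite -gE.
Qed.

Lemma bij_hom_inv (M N : gmod k G) (f : {linear M -> N}) : is_hom f -> bijective f ->
  exists g : {linear N -> M}, [/\ is_hom g, cancel f g & cancel g f].
Proof.
move=> fh [g fK gK]; have gl : linear g.
  by move=> a u v; apply: (can_inj fK); rewrite linearP !gK.
pose gL : {linear N -> M} := HB.pack g (GRing.isLinear.Build k N M *:%R g gl).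
by exists gL; split=> // h v; apply: (can_inj fK); rewrite fh /= !gK.
Qed.

Lemma irreducible_iso (M X : gmod k G) : gmod_iso M X -> irreducible_mod X ->
  irreducible_mod M.
Proof.
move=> [h [hh [h' hK h'K]]] irrX K [v vK v0] w.
have hi : injective h := can_inj hK.
have hvK : h v \in smem (im_submod hh K) by apply/asboolP; exists v.
have hv0 : h v != 0 by apply: contra v0 => /eqP hv; rewrite -(hK v) hv -(linear0 h) hK.
by have /asboolP[u uK /hi ->] := irrX _ (ex_intro2 _ _ (h v) hvK hv0) (h w).
Qed.

Lemma in_C_iso (M X : gmod k G) : gmod_iso M X -> in_C X -> in_C M.
Proof.
move=> [h [hh hb]] [n [[e [e_free e_span]] [xi [xi_eig [phi [phiB phi_inj phi_im]]]]]].
have [g [gh hK gK]] := bij_hom_inv hh hb.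
have hi := can_inj hK; have gi := can_inj gK.
have eig_h v : eigenvector v -> eigenvector (h v).
  by move=> [lam vw]; exists lam => t; rewrite -hh vw linearZ.
have eig_g v : eigenvector v -> eigenvector (g v).
  by move=> [lam vw]; exists lam => t; rewrite -gh vw linearZ.
exists n; split.
  exists (g \o e); split=> [c c0|v].
    apply: e_free; apply: gi; rewrite linear0 -[RHS]c0 linear_sum.
    by apply: eq_bigr => i _; rewrite linearZ.
  have -> : torus_part v <-> torus_part (h v).
    split=> -[m [c [f [fE Dv]]]].
      exists m, c, (h \o f); split=> [i|]; first exact: eig_h.
      by rewrite Dv linear_sum; apply: eq_bigr => i _; rewrite linearZ.
    exists m, c, (g \o f); split=> [i|]; first exact: eig_g.
    by rewrite -[v]hK Dv linear_sum; apply: eq_bigr => i _; rewrite linearZ.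
  split=> [/e_span[c Dv]|[c ->]].
    exists c; rewrite -[v]hK Dv linear_sum; apply: eq_bigr => i _.
    by rewrite linearZ.
  apply/e_span; exists c; rewrite linear_sum; apply: eq_bigr => i _.
  by rewrite linearZ /= gK.
exists (g \o xi); split=> [i|]; first exact: eig_g.
pose psi v : {ffun 'I_n -> M} := [ffun i => g ((phi (h v) : {ffun _ -> _}) i)].
have psi_lin : linear psi.
  by move=> a u v; apply/ffunP => i; rewrite !ffunE !linearP !ffunE linearP.
pose psiL : {linear gmod_res (@borel_incl F) M -> gmod_pow n (gmod_res (@borel_incl F) M)} :=
  HB.pack psi (GRing.isLinear.Build k (gmod_res (@borel_incl F) M)
    (gmod_pow n (gmod_res (@borel_incl F) M)) *:%R psi psi_lin).
have span_h i x : unip_span ((g \o xi) i) x <-> unip_span (xi i) (h x).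
  split=> /unip_spanP[l Dx]; apply/unip_spanP; exists l.
    rewrite Dx linear_sum; apply: eq_bigr => p _.
    by rewrite linearZ /= hh gK.
  rewrite -[x]hK Dx linear_sum; apply: eq_bigr => p _.
  by rewrite linearZ /= gh.
exists psiL; split.
- move=> b v; apply/ffunP => i; rewrite !ffunE.
  have -> : h (gact b (v : gmod_res (@borel_incl F) M)) =
     gact b (h v : gmod_res (@borel_incl F) X) by exact: hh.
  by rewrite phiB ffunE -gh.
- move=> u v uv; apply: hi; apply: phi_inj; apply/ffunP => i; apply: gi.
  by have /ffunP/(_ i) := uv; rewrite !ffunE.
move=> x; split=> [[v <-] i|xE].
  by apply/span_h; rewrite ffunE gK; move: i; apply/phi_im; exists (h v).
have [|v Dv] := (phi_im [ffun i => h (x i)]).2.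
  by move=> i; rewrite ffunE; apply/span_h.
by exists (g v); apply/ffunP => i; rewrite ffunE gK Dv ffunE hK.
Qed.

Lemma simple_listed (M : gmod k G) : simple_in (@in_C k F) M ->
  exists2 X, listed X & gmod_iso M X.
Proof.
move=> [MC [v /eqP v0] Msimple].
have allC : submod_closed (predT : {pred M}) by split.
pose K := Submod allC (fun g v (_ : v \in predT) => isT : gact g v \in predT).
have [X [g [x [XL gh _ gx]]]] := listed_maps char0 finF (K := K) MC (isT : v \in smem K) v0.
have gi := inj_of_irreducible (listed_irreducible char0 finF XL) gh gx.
exists X => //; have [|g0|gb] := Msimple X (listed_in_C XL) g gh.
- by move=> Y _ a b _ _ ab y; apply: gi.
- by rewrite g0 eqxx in gx.
have [h [hh gK hK]] := bij_hom_inv gh gb.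
by exists h; split=> //; exists g.
Qed.

Lemma listed_simple (M X : gmod k G) : listed X -> gmod_iso M X ->
  simple_in (@in_C k F) M.
Proof.
move=> XL MX; have irrM := irreducible_iso MX (listed_irreducible char0 finF XL).
split; first exact: in_C_iso MX (listed_in_C XL).
  have [x x0] : exists x : X, x <> 0.
    case: XL MX irrM => [->|->|[theta _ ->]] _ _.
    - by exists (1 : k^o); apply/eqP; exact: oner_neq0.
    - have [e [_ _ fe]] := @St_generator k F; exists e => e0.
      have := fe [:: (0, 1)]; rewrite /lsum big_seq1 e0 linear0 scaler0 => /(_ erefl 0).
      by rewrite /lcoef big_cons big_nil eqxx addr0 => /eqP; rewrite oner_eq0.
    have [ci [_ [c1 _ _ _]]] := ind_coord theta; exists (ind_one theta) => E.
    by move: c1; rewrite E linear0 => /esym/eqP; rewrite oner_eq0.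
  have [h [hh [h' hK h'K]]] := MX; exists (h' x) => hx; apply: x0.
  by rewrite -[x]h'K hx linear0.
move=> N NC f fh fmono.
have [f0|/existsNP[x /eqP fx]] := pselect (forall x, f x = 0); [by left|right].
apply: bij_of_inj_surj (surj_of_irreducible irrM fh fx).
move=> u v fuv; apply/eqP; rewrite -subr_eq0; apply/negPn/negP => uv.
have uvK : u - v \in smem (ker_submod fh) by rewrite inE linearB fuv subrr.
have [Y [g [y [YL gh gK gy]]]] := listed_maps char0 finF NC uvK uv.
pose fg : {linear Y -> M} := f \o g.
have fgh : is_hom fg by move=> a z; rewrite /= gh fh.
have gker z : f (g z) = 0.
  apply/eqP/negPn/negP => fgz.
  have fgi := inj_of_irreducible (listed_irreducible char0 finF YL) fgh fgz.
  case/eqP: gy; suff -> : y = 0 by rewrite linear0.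
  by apply: fgi; rewrite linear0; apply/eqP; move: gK; rewrite inE.
have zh : is_hom (\0 : {linear Y -> N}) by move=> a z; rewrite /= linear0.
case/eqP: gy; apply: (fmono Y (listed_in_C YL) g \0 gh zh) => z.
by rewrite gker linear0.
Qed.

End Simple.

Theorem mainTheorem2 (Fq : finFieldType) (F : closedFieldType)
    (iota : {rmorphism Fq -> F}) (algF : forall x : F, algebraicOver iota x)
    (k : closedFieldType) (char0 : [pchar k] =i pred0)
    (M : gmod k (SL2 F)) :
  simple_in (@in_C k F) M <->
  [\/ gmod_iso M (k_tr k F), gmod_iso M (St k F) |
      exists theta : {multiplicative torus F -> units k},
        (exists t, theta t <> 1%g) /\ gmod_iso M (M_theta theta)].
Proof.
have finF := finite_subfields algF; split.
  move=> /(simple_listed char0 finF)[X [->|->|[theta nt ->]] MX].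
  - by constructor 1.
  - by constructor 2.
  by constructor 3; exists theta.
case=> [MX|MX|[theta [nt MX]]].
- by apply: (listed_simple char0 finF _ MX); constructor 1.
- by apply: (listed_simple char0 finF _ MX); constructor 2.
by apply: (listed_simple char0 finF _ MX); constructor 3; exists theta.
Qed.
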